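(* For every integer $r\geq 2$ there exists $C\geq r$ such that, with $p=p(n)\in[0,1]$, the following hold asymptotically almost surely: (i) if $p\ge \left(\frac{27\log n}{n}\right)^{1/3}$, then $\mathrm{tp}_2(G(n,p)) \le 2$; (ii) if $p\geq \left(\frac{C\log n}{n}\right)^{1/(r+1)}$, then $\mathrm{tc}_r(G(n,p))\leq r^2$; (iii) if $p\ge \left(\frac{C\log n}{n}\right)^{1/r}$, then in every $r$-coloring of the edges of $G(n,p)$ there is a collection of $r$ vertex-disjoint monochromatic trees which cover all but at most $9r\log n /p=O\left(n^{1/r}(\log n)^{1-1/r}\right)$ vertices.
   Context: $G(n,p)$ is the binomial random graph on $n$ vertices in which each pair is an edge independently with probability $p=p(n)$. A sequence of events $A_n$ holds asymptotically almost surely (a.a.s.) if $\Pr[A_n]\to 1$ as $n\to\infty$. $\log$ is the natural logarithm. An $r$-coloring of a graph is an arbitrary assignment of one of $r$ colors to each edge. The $r$-color tree-partition number $\mathrm{tp}_r(G)$ (resp. tree-cover number $\mathrm{tc}_r(G)$) is the minimum $s$ such that for every $r$-coloring of the edges of $G$ there exists a collection of monochromatic connected subgraphs $\{H_1,\dots,H_t\}$ with $t\leq s$ such that $\{V(H_1),\dots,V(H_t)\}$ is a partition (resp. a cover) of $V(G)$. ''A collection of $r$ trees'' is to be understood as at most $r$ trees; a single vertex counts as a monochromatic tree. *)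

(* Defs.v *)
From mathcomp Require Import all_boot all_order all_algebra.

Set Implicit Arguments.
Unset Strict Implicit.
Unset Printing Implicit Defensive.

(* A simple graph on the vertex type V is identified with its edge set, and
   an edge is an unordered pair of distinct vertices. *)
Notation vpair V := {e : {set V} | #|e| == 2%N}.
Notation graph V := {set vpair V}.

(* The pair (V(H), E(H)); well-formedness is part of [subgraph_of]. *)
Notation subgraph V := ({set V} * {set vpair V})%type.

(* Total on all pairs, but only the values on the edges of the graph matter. *)
Notation coloring V r := {ffun vpair V -> 'I_r}.

Definition adj (V : finType) (F : graph V) : rel V :=
  [rel x y | [exists e in F, val e == [set x; y]]].

Definition subgraph_of (V : finType) (G : graph V) (H : subgraph V) : bool :=
  (H.2 \subset G) && [forall e in H.2, val e \subset H.1].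

Definition connected_graph (V : finType) (H : subgraph V) : bool :=
  (H.1 != set0) && [forall x in H.1, forall y in H.1, connect (adj H.2) x y].

(* The bound is 2 rather than 0 because [ucycle] also accepts the empty
   sequence and, for every edge xy, the closed walk x, y. *)
Definition acyclic_graph (V : finType) (H : subgraph V) : Prop :=
  forall c : seq V, ucycle (adj H.2) c -> size c <= 2.

Definition monochromatic (V : finType) (r : nat) (f : coloring V r)
    (H : subgraph V) : bool :=
  [forall e in H.2, forall e' in H.2, f e == f e'].

Definition mono_connected (V : finType) (G : graph V) (r : nat)
    (f : coloring V r) (H : subgraph V) : bool :=
  [&& subgraph_of G H, monochromatic f H & connected_graph H].

Definition mono_tree (V : finType) (G : graph V) (r : nat)
    (f : coloring V r) (H : subgraph V) : Prop :=
  mono_connected G f H /\ acyclic_graph H.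

Definition vertex_sets (V : finType) (HH : {set subgraph V}) : {set {set V}} :=
  [set H.1 | H in HH].

Definition vertex_disjoint (V : finType) (HH : {set subgraph V}) : Prop :=
  {in HH &, forall H H' : subgraph V, H != H' -> [disjoint H.1 & H'.1]}.

Definition uncovered (V : finType) (HH : {set subgraph V}) : {set V} :=
  ~: cover (vertex_sets HH).

Definition tree_partitionable (V : finType) (G : graph V) (r s : nat) : bool :=
  [forall f : coloring V r, exists HH : {set subgraph V},
    [&& #|HH| <= s, [forall H in HH, mono_connected G f H]
      & partition (vertex_sets HH) [set: V]]].

Definition tree_coverable (V : finType) (G : graph V) (r s : nat) : bool :=
  [forall f : coloring V r, exists HH : {set subgraph V},
    [&& #|HH| <= s, [forall H in HH, mono_connected G f H]
      & cover (vertex_sets HH) == [set: V]]].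

Lemma ex_tree_partitionable (V : finType) (G : graph V) (r : nat) :
  exists s, tree_partitionable G r s.
Proof.
exists #|V|; apply/forallP => f; apply/existsP.
pose single (x : V) : subgraph V := ([set x], set0).
exists (single @: [set: V]); apply/and3P; split.
- by rewrite -cardsT leq_imset_card.
- apply/forall_inP => _ /imsetP[x _ ->]; apply/and3P; split.
  + by rewrite /subgraph_of sub0set; apply/forall_inP => e; rewrite inE.
  + by apply/forall_inP => e; rewrite inE.
  + rewrite /connected_graph -card_gt0 cards1 /=.
    apply/forall_inP => y /set1P->; apply/forall_inP => z /set1P->.
    exact: connect0.
- rewrite /vertex_sets -imset_comp; apply/and3P; split.
  + apply/eqP/setP => x; rewrite inE; apply/bigcupP.
    by exists [set x]; rewrite ?set11 //; apply/imsetP; exists x.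
  + apply/trivIsetP => _ _ /imsetP[x _ ->] /imsetP[y _ ->] /= xy.
    by rewrite disjoints1 inE; apply: contra xy => /eqP->.
  + by apply/imsetP => -[x _ /setP/(_ x)]; rewrite !inE eqxx.
Qed.

Lemma ex_tree_coverable (V : finType) (G : graph V) (r : nat) :
  exists s, tree_coverable G r s.
Proof.
have [s /forallP Gs] := ex_tree_partitionable G r.
exists s; apply/forallP => f.
have /existsP[HH /and3P[sHH mHH pHH]] := Gs f.
by apply/existsP; exists HH; rewrite sHH mHH (cover_partition pHH) eqxx.
Qed.

Definition tp (V : finType) (r : nat) (G : graph V) : nat :=
  ex_minn (ex_tree_partitionable G r).

Definition tc (V : finType) (r : nat) (G : graph V) : nat :=
  ex_minn (ex_tree_coverable G r).

(* Loaded only here because its [set0], [cover], [partition], ... on classical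
   sets would otherwise shadow those of finset used above. *)
From mathcomp Require Import all_classical all_reals all_analysis.
Import numFieldNormedType.Exports.

Local Open Scope ring_scope.
Local Open Scope classical_set_scope.

(* Probability that G(V, p) satisfies A: the law of the random graph gives
   weight p to every edge and 1 - p to every non-edge, independently. *)
Definition Gnp_pr (R : realType) (V : finType) (p : R) (A : graph V -> Prop) : R :=
  \sum_(G : graph V | `[< A G >])
    \prod_(e : vpair V) (if e \in G then p else 1 - p).

Definition aas (R : realType) (p : nat -> R)
    (A : forall n : nat, graph 'I_n -> Prop) : Prop :=
  (fun n : nat => Gnp_pr (p n) (A n)) @ \oo --> (1 : R).

(* Main.v *)
(* All three parts reduce to deterministic properties of G whose failure
   has small expected weight under G(n, p).

   (ii) If any r + 1 vertices have a common neighbour, two of the r + 1 edges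
   to it share a colour, so at most r vertices lie pairwise in different
   components in every colour; the components of a maximal such family cover.

   (i) Any three vertices have many common neighbours. By (a small case of)
   Koenig's theorem, V is covered by two red components, or by two blue ones,
   or by a red component A and a blue one B. In the last case there is no edge
   between x in A \ B and y in B \ A, and their common neighbours S are joined
   to x in red and to y in blue. A random splitting of S between x and y
   attaches every other vertex to one of the two sides.

   (iii) Build greedily a set S and vertices x_i, for i in a set C of colours,
   such that x_i is joined to S in colour i; while some vertex sends a
   positive proportion of its edges to S in a new colour, extend C and shrink
   S by a factor of order p. A random splitting of S into stars attaches every
   vertex with many edges to S in the colours of C. If the process stops before
   |C| = r - 1, then few vertices are left, as edges are equidistributed
   between large sets. Otherwise the vertices left over send almost all their
   edges to S in the last colour, and by equidistribution almost all of them
   lie in one component in that colour. *)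
Require Import Defs.
From mathcomp Require Import all_boot all_order all_algebra.
From mathcomp Require Import ring lra zify.
Import Order.TTheory GRing.Theory Num.Theory.

Set Implicit Arguments.
Unset Strict Implicit.
Unset Printing Implicit Defensive.

(** * Monochromatic trees *)

Lemma adjP (V : finType) (F : graph V) (x y : V) :
  reflect (exists2 e, e \in F & val e = [set x; y]) (adj F x y).
Proof.
apply: (iffP existsP) => [[e /andP[eF /eqP exy]] | [e eF exy]]; exists e => //.
by rewrite eF exy eqxx.
Qed.

Lemma adj_symmetric (V : finType) (F : graph V) : symmetric (adj F).
Proof. by move=> x y; apply/adjP/adjP => -[e eF exy]; exists e => //; rewrite setUC. Qed.

Lemma adj_connect_sym (V : finType) (F : graph V) : connect_sym (adj F).
Proof. exact/sym_connect_sym/adj_symmetric. Qed.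

Lemma adj_neq (V : finType) (F : graph V) (x y : V) : adj F x y -> x != y.
Proof.
by case/adjP=> e _ exy; have := valP e; rewrite exy cards2; case: (x != y).
Qed.

Lemma set2_eqP (V : finType) (x y u v : V) :
  [set x; y] = [set u; v] -> (x = u /\ y = v) \/ (x = v /\ y = u).
Proof.
move=> xyuv.
have : x \in [set u; v] by rewrite -xyuv set21.
have : y \in [set u; v] by rewrite -xyuv set22.
have : u \in [set x; y] by rewrite xyuv set21.
have : v \in [set x; y] by rewrite xyuv set22.
by move=> /set2P[] vE /set2P[] uE /set2P[] yE /set2P[] xE; subst; auto.
Qed.

(** An inclusion-minimal edge set that keeps [W] connected is acyclic: an edge of a cycle of length
    at least three could be deleted, since the rest of the cycle replaces it. *)
Lemma connect_spanning_tree (V : finType) (W : {set V}) (E : graph V) :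
  connected_graph (W, E) ->
  exists E' : graph V, [/\ E' \subset E, connected_graph (W, E') & acyclic_graph (W, E')].
Proof.
move=> EW; have [E' minE' subE] := minset_exists (P := fun F => connected_graph (W, F)) EW.
have cE' := minsetp minE'.
exists E'; split=> //= -[//|x [//|y [//|z s]]] /andP[/=].
rewrite rcons_path /= => /and4P[/adjP[e eE' exy] yz zs lx].
rewrite !inE !negb_or -!andbA => /and5P[xy xz xs yz' /andP[ys _]].
pose E1 := E' :\ e.
have neq_e a b d : a \notin [set x; y] -> d \in E' -> val d = [set a; b] -> d \in E1.
  move=> axy dE dab; rewrite !inE dE andbT; apply: contra axy => /eqP de.
  by rewrite -exy -de dab set21.
have sub1 a b : a \notin [set x; y] -> adj E' a b -> adj E1 a b.
  by move=> axy /adjP[d dE dab]; apply/adjP; exists d => //; apply: neq_e dab.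
(* The rest of the cycle avoids [e]: its vertices are distinct, so each of its edges has an endpoint
   outside [[set x; y]]. *)
have yx : connect (adj E1) y x.
  apply/connectP; exists (rcons (z :: s) x); last by rewrite last_rcons.
  rewrite rcons_path /= -andbA; apply/and3P; split.
  - by rewrite adj_symmetric; apply: sub1; rewrite 1?adj_symmetric // !inE negb_or eq_sym xz eq_sym yz'.
  - apply: (sub_in_path (P := [pred a | a \notin [set x; y]])) zs => [a b /= axy _|]; first exact: sub1.
    apply/allP => a azs; rewrite /= !inE negb_or.
    by apply/andP; split; apply/eqP=> ?; subst a; move: azs; rewrite inE;
       [case: eqVneq xz | case: eqVneq yz'] => //= _ _; apply/negP.
  - apply: sub1 lx; rewrite !inE negb_or; have := mem_last z s; rewrite inE.
    case/predU1P=> [->|ls]; first by rewrite !(eq_sym z) xz yz'.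
    by apply/andP; split; [apply: contraNneq xs | apply: contraNneq ys] => <-.
have /minsetP[_ minE1] := minE'.
suff: connected_graph (W, E1).
  by move=> /minE1/(_ (subsetDl _ _))/setP/(_ e); rewrite !inE eqxx eE'.
rewrite /connected_graph /=; case/andP: cE' => -> /= /forall_inP cW.
apply/forall_inP=> u uW; apply/forall_inP=> v vW.
move: (forall_inP (cW u uW) v vW); apply: connect_sub => {u v uW vW} u v /adjP[d dE' duv].
have [de|de] := eqVneq d e; last first.
  by apply: connect1; apply/adjP; exists d => //; rewrite !inE de dE'.
have := set2_eqP (etrans (esym duv) (etrans (congr1 val de) exy)).
by case=> [[-> ->]|[-> ->]] //; rewrite adj_connect_sym.
Qed.

Section ColorGraphs.
Variables (V : finType) (G : graph V) (r : nat) (f : coloring V r).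

Definition color_graph (i : 'I_r) (W : {set V}) : graph V :=
  [set e in G | (f e == i) && (val e \subset W)].

Definition cadj (i : 'I_r) : rel V := adj (color_graph i setT).

Definition color_connected (i : 'I_r) (W : {set V}) : bool :=
  connected_graph (W, color_graph i W).

(** The component of [v] in the colour-[i] graph induced on [W]; it is the singleton of [v] when [v]
    is outside [W]. *)
Definition color_class (i : 'I_r) (W : {set V}) (v : V) : {set V} :=
  [set w | connect (adj (color_graph i W)) v w].

Lemma adj_color_graph i (W : {set V}) x y :
  adj (color_graph i W) x y = [&& cadj i x y, x \in W & y \in W].
Proof.
apply/adjP/and3P => [[e]|[/adjP[e]]].
  rewrite !inE => /and3P[eG fe eW] exy; split.
  - by apply/adjP; exists e => //; rewrite !inE eG fe subsetT.
  - by apply: (subsetP eW); rewrite exy set21.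
  - by apply: (subsetP eW); rewrite exy set22.
rewrite !inE => /and3P[eG fe _] exy xW yW; exists e => //.
by rewrite !inE eG fe exy subUset !sub1set xW yW.
Qed.

Lemma cadj_sym i : symmetric (cadj i).
Proof. exact: adj_symmetric. Qed.

Lemma adj_cadj x y : adj G x y -> exists i, cadj i x y.
Proof.
by case/adjP=> e eG exy; exists (f e); apply/adjP; exists e => //; rewrite !inE eG eqxx subsetT.
Qed.

Lemma cadj_inj i j x y : cadj i x y -> cadj j x y -> i = j.
Proof.
case/adjP=> e; rewrite !inE => /and3P[_ /eqP<- _] exy.
case/adjP=> e'; rewrite !inE => /and3P[_ /eqP<- _] e'xy.
by congr (f _); apply: val_inj; rewrite exy e'xy.
Qed.

(** A path starting at [v] visits only vertices of the class, so it survives the restriction to the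
    class. *)
Lemma color_class_connected i W v : color_connected i (color_class i W v).
Proof.
have vv : v \in color_class i W v by rewrite inE connect0.
apply/andP; split; first by apply/set0Pn; exists v.
set K := color_class _ _ _ in vv *.
suff vK w : w \in K -> connect (adj (color_graph i K)) v w.
  apply/forall_inP=> x /vK vx; apply/forall_inP=> y /vK; apply: connect_trans.
  by rewrite adj_connect_sym.
rewrite inE => /connectP[p]; elim/last_ind: p w => [w _ -> //|p z IHp w].
rewrite rcons_path last_rcons => /andP[vp lz] ->.
have lK : last v p \in K by rewrite inE; apply/connectP; exists p.
apply: connect_trans (IHp _ vp erefl) (connect1 _).
move: (lz); rewrite !adj_color_graph lK => /and3P[-> _ _] /=.
by rewrite inE in lK; rewrite inE (connect_trans lK) ?connect1.
Qed.

Lemma color_connected_mono i W :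
  color_connected i W -> mono_connected G f (W, color_graph i W).
Proof.
move=> cW; apply/and3P; split=> //.
  apply/andP; split; first by apply/subsetP=> e; rewrite inE => /andP[].
  by apply/forall_inP=> e; rewrite inE => /and3P[].
apply/forall_inP=> e; rewrite inE => /and3P[_ /eqP-> _].
by apply/forall_inP=> e'; rewrite inE => /and3P[_ /eqP-> _].
Qed.

Lemma color_connected_tree i W :
  color_connected i W -> exists2 H : subgraph V, H.1 = W & mono_tree G f H.
Proof.
move=> cW; have [E' [subE cE' aE']] := connect_spanning_tree cW.
exists (W, E') => //; split=> //.
have /and3P[/andP[sG sW] mono _] := color_connected_mono cW.
apply/and3P; split=> //.
  apply/andP; split; first exact: subset_trans sG.
  by apply/forall_inP=> e /(subsetP subE); apply/forall_inP: e.
apply/forall_inP=> e /(subsetP subE) eE; apply/forall_inP=> e' /(subsetP subE).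
exact: (forall_inP (forall_inP mono e eE)).
Qed.

(** Each nonempty piece is replaced by a spanning tree. Empty pieces are allowed, so that one piece
    per colour can be declared in advance; they yield no tree. *)
Lemma disjoint_tree_family (I : finType) (W : I -> {set V}) (c : I -> 'I_r) :
  (forall i j, i != j -> [disjoint W i & W j]) ->
  (forall i, W i != set0 -> color_connected (c i) (W i)) ->
  exists HH : {set subgraph V},
    [/\ (#|HH| <= #|I|)%N, forall H, H \in HH -> mono_tree G f H,
        vertex_disjoint HH & uncovered HH = ~: \bigcup_i W i].
Proof.
move=> disW conW.
have /fin_all_exists[T TP] i : exists H : subgraph V, W i != set0 -> H.1 = W i /\ mono_tree G f H.
  have [_|/conW/color_connected_tree[H HW Ht]] := eqVneq (W i) set0; last by exists H.
  by exists (set0, set0).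
exists (T @: [set i | W i != set0]); split.
- exact: leq_trans (leq_imset_card _ _) (max_card _).
- by move=> _ /imsetP[i + ->]; rewrite inE => /TP[].
- move=> _ _ /imsetP[i + ->] /imsetP[j + ->]; rewrite !inE => /TP[Wi _] /TP[Wj _] Tij.
  by rewrite Wi Wj; apply: disW; apply: contraNneq Tij => ->.
- congr (~: _); apply/setP=> x; apply/bigcupP/bigcupP=> [[B /imsetP[H /imsetP[i +] -> ->]]|[i _ xi]].
    by rewrite inE => /TP[-> _]; exists i.
  have Wi : W i != set0 by apply/set0Pn; exists x.
  exists (W i) => //; apply/imsetP; exists (T i); last by case: (TP i Wi).
  by apply: imset_f; rewrite inE.
Qed.

End ColorGraphs.

(** * Covers by components *)

Lemma subset_card_exists (T : finType) (A : {set T}) (m : nat) :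
  m <= #|A| -> exists2 B : {set T}, B \subset A & #|B| = m.
Proof.
move=> mA; exists [set x in take m (enum A)].
  by apply/subsetP=> x; rewrite inE => /mem_take; rewrite mem_enum.
rewrite cardsE (card_uniqP _) ?size_takel -?cardE //.
exact/take_uniq/enum_uniq.
Qed.

Lemma tree_cover_number_le (V : finType) (G : graph V) (r : nat) :
  (forall M : {set V}, #|M| = r.+1 -> exists z, {in M, forall u, adj G z u}) ->
  tc r G <= r ^ 2.
Proof.
move=> comG; rewrite /tc; case: ex_minnP => s _; apply.
apply/forallP=> f.
pose indep (M : {set V}) := [forall x in M, forall y in M,
  (x != y) ==> [forall i, ~~ connect (cadj G f i) x y]].
have indep0 : indep set0 by apply/forall_inP=> x; rewrite inE.
have [M /maxsetP[indM maxM] _] := maxset_exists indep0.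
have Mr : #|M| <= r.
  rewrite leqNgt; apply/negP=> /subset_card_exists[M' subM cM'].
  have [z zM'] := comG _ cM'.
  have /card_gt0P[u0 /zM'/(adj_cadj f)[i0 _]] : 0 < #|M'| by rewrite cM'.
  have /fin_all_exists[c cP] u : exists i, u \in M' -> cadj G f i z u.
    have [/zM'/(adj_cadj f)[i ziu]|_] := boolP (u \in M'); first by exists i.
    by exists i0.
  (* Pigeonhole: [c] maps the [r.+1] vertices of [M'] to [r] colours. *)
  have /dinjectivePn : ~~ dinjectiveb c M'.
    apply/negP=> /dinjectiveP/card_in_imset; rewrite cM' => cr.
    by have := max_card (mem (c @: M')); rewrite cr card_ord ltnn.
  move=> [u uM' [w /andP[uw wM'] cuw]].
  have /forall_inP/(_ _ (subsetP subM _ uM'))/forall_inP/(_ _ (subsetP subM _ wM')) := indM.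
  move=> /implyP; rewrite eq_sym => /(_ uw)/forallP/(_ (c u))/negP; apply.
  apply: (@connect_trans _ _ z); apply: connect1; first by rewrite cadj_sym cP.
  by rewrite cuw cP.
pose comp (mi : V * 'I_r) : subgraph V := let W := color_class G f mi.2 setT mi.1 in
  (W, color_graph G f mi.2 W).
apply/existsP; exists (comp @: setX M setT); apply/and3P; split.
- apply: leq_trans (leq_imset_card _ _) _.
  by rewrite cardsX cardsT card_ord expnS expn1 leq_mul2r Mr orbT.
- apply/forall_inP=> _ /imsetP[[m i] _ ->].
  exact/color_connected_mono/color_class_connected.
- apply/eqP/setP=> v; rewrite !inE; apply/bigcupP.
  suff [m mM [i mv]] : exists2 m, m \in M & exists i, connect (cadj G f i) m v.
    exists (comp (m, i)).1; last by rewrite inE.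
    by apply: imset_f; apply: imset_f; rewrite !inE mM.
  have [vM|vM] := boolP (v \in M).
    have r0 : 0 < r by apply: leq_trans Mr; apply/card_gt0P; exists v.
    by exists v => //; exists (Ordinal r0); apply: connect0.
  (* A vertex in no component of a vertex of [M] could be added to [M], against maximality. *)
  have [/forall_inP vi|] := boolP [forall m in M, [forall i, ~~ connect (cadj G f i) m v]].
    have /maxM/(_ (subsetUr _ _)) vMM : indep (v |: M); last by rewrite -vMM setU11 in vM.
    apply/forall_inP=> x /setU1P[->|xM]; apply/forall_inP=> y /setU1P[->|yM]; apply/implyP=> xy.
    - by rewrite eqxx in xy.
    - by apply/forallP=> i; rewrite adj_connect_sym; apply: (forallP (vi y yM)).
    - exact: vi.
    - exact: (implyP (forall_inP (forall_inP indM x xM) y yM)).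
  rewrite negb_forall_in => /exists_inP[m mM]; rewrite negb_forall => /existsP[i].
  by rewrite negbK => mv; exists m => //; exists i.
Qed.

(** * Random assignments *)

Section RandomAssignments.
Local Open Scope ring_scope.


Lemma sumr_uniform (R : realFieldType) (V : finType) (a : R) :
  (0 < #|V|)%N -> \sum_(v : V) a / #|V|%:R = a.
Proof. by move=> V0; rewrite sumr_const -[LHS]mulr_natr divfK // pnatr_eq0 -lt0n. Qed.

Lemma card_sep (T : finType) (S : {set T}) (P : pred T) :
  #|[set s in S | P s]| = (\sum_(s in S) P s)%N.
Proof.
rewrite -sum1_card [LHS]big_mkcond [RHS]big_mkcond /=; apply: eq_bigr => s _.
by rewrite inE; case: (s \in S); case: (P s).
Qed.

(** First moment principle. If all [X i < y], the nonnegative terms [mu i * (y - X i)] sum to 0,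
    which forces [mu = 0]. *)
Lemma mean_attained (R : realFieldType) (I : finType) (mu X : I -> R) (y : R) :
  (forall i, 0 <= mu i) -> \sum_i mu i = 1 -> \sum_i mu i * X i = y ->
  exists i, y <= X i.
Proof.
move=> mu0 mu1 muX; apply/existsP/contraT; rewrite negb_exists => /forallP Xy.
have Xy' i : X i < y by rewrite ltNge.
have : \sum_i mu i * (y - X i) == 0.
  under eq_bigr do rewrite mulrBr; rewrite big_split /= sumrN muX -mulr_suml mu1; lra.
rewrite psumr_eq0 => [/allP mu00|i _]; last by rewrite mulr_ge0 // subr_ge0 ltW.
have : \sum_i mu i = 0.
  apply: big1 => i _; have := mu00 i (mem_index_enum i).
  by rewrite /= mulf_eq0 subr_eq0 (gt_eqF (Xy' i)) orbF => /eqP.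
by rewrite mu1 => /eqP; rewrite oner_eq0.
Qed.

(** The values of a uniformly random function are independent: the sum over functions of a product
    is a product of sums. *)
Lemma uniform_function_product (R : realFieldType) (V : finType) (r : nat)
    (P : V -> pred 'I_r) :
  \sum_(h : {ffun V -> 'I_r}) r%:R^-1 ^+ #|V| * [forall u, P u (h u)]%:R
    = \prod_u (#|P u|%:R / r%:R) :> R.
Proof.
transitivity (\sum_(h : {ffun V -> 'I_r}) \prod_u (r%:R^-1 * (P u (h u))%:R : R)).
  apply: eq_bigr => h _; rewrite big_split /= prodr_const; congr (_ * _).
  have [/forallP Ph|] := boolP [forall u, P u (h u)].
    by rewrite big1 // => u _; rewrite Ph.
  by move=> /forallPn[u /negbTE Pu]; rewrite (bigD1 u) //= Pu mul0r.
rewrite -(bigA_distr_bigA (fun u j => r%:R^-1 * (P u j)%:R)).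
apply: eq_bigr => u _; rewrite -mulr_sumr mulrC; congr (_ * _).
by rewrite -sum1_card natr_sum [in RHS]big_mkcond /=; apply: eq_bigr => j _; rewrite unfold_in; case: (P u j).
Qed.

(** For a uniformly random [h], [q] is the expected number of [v] in [T] such that [h u] differs
    from [c v u] for all [u] in [N v]. *)
Lemma exists_assignment (R : realFieldType) (V : finType) (r : nat) (T S : {set V})
    (N : V -> {set V}) (c : V -> V -> 'I_r) (c0 : 'I_r) :
  let q : R := \sum_(v in T) (1 - r%:R^-1) ^+ #|N v| in
  q < r%:R^-1 -> S != set0 ->
  exists h : V -> 'I_r,
    {in T, forall v, exists2 u, u \in N v & h u = c v u} /\
    #|S|%:R * (r%:R^-1 - q) <= #|[set s in S | h s == c0]|%:R.
Proof.
move=> q qr S0.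
have r0 : r%:R != 0 :> R by case: (r) c0 => [[]//|n] _; rewrite pnatr_eq0.
pose mu (h : {ffun V -> 'I_r}) : R := r%:R^-1 ^+ #|V|.
pose bad (h : {ffun V -> 'I_r}) v := [forall u, (u \in N v) ==> (h u != c v u)].
(* The penalty [#|S|] per bad vertex lets one variable control both conclusions: its mean
   [#|S| * (1/r - q)] is positive, while a single bad vertex makes it at most 0. *)
pose X (h : {ffun V -> 'I_r}) : R := \sum_(s in S) (h s == c0)%:R - #|S|%:R * \sum_(v in T) (bad h v)%:R.
have [||| h hX] := @mean_attained R _ mu X (#|S|%:R * (r%:R^-1 - q)).
- by move=> h; rewrite exprn_ge0 // invr_ge0.
- have := @uniform_function_product R V r (fun _ _ => true).
  rewrite (eq_bigr mu) => [->|h _]; last by rewrite (introT forallP (fun=> isT)) mulr1.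
  by apply: big1 => u _; rewrite cardT size_enum_ord divff.
- under eq_bigr => h _ do rewrite /X mulrBr mulrCA.
  rewrite sumrB -[X in _ - X]mulr_sumr mulrBr; congr (_ - _ * _).
    under eq_bigr => h _ do rewrite mulr_sumr.
    rewrite exchange_big /=.
    rewrite -sumr_const mulr_suml; apply: eq_bigr => s _; rewrite mul1r.
    transitivity (\sum_h mu h * [forall u, (u == s) ==> (h u == c0)]%:R).
      apply: eq_bigr => h _; congr (_ * _%:R); congr nat_of_bool.
      by apply/idP/forallP=> [hs u|/(_ s)]; [apply/implyP=> /eqP->|rewrite eqxx].
    rewrite (uniform_function_product R (fun u j => (u == s) ==> (j == c0))) (bigD1 s) //=.
    rewrite eqxx /= (eq_card1 (x := c0)) // mul1r big1 ?mulr1 // => u /negbTE us.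
    by rewrite us /= card_ord divff.
  under eq_bigr => h _ do rewrite mulr_sumr.
  rewrite exchange_big /=; apply: eq_bigr => v _.
  rewrite (uniform_function_product R (fun u j => (u \in N v) ==> (j != c v u))).
  rewrite (bigID (mem (N v))) /= [X in _ * X]big1 ?mulr1 => [|u /negbTE->]; last first.
    by rewrite /= card_ord divff.
  rewrite -prodr_const; apply: eq_bigr => u ->.
  rewrite (eq_card (B := predC1 (c v u))) // cardC1 card_ord.
  by rewrite -subn1 natrB ?mulrBl ?divff ?mul1r // lt0n -(pnatr_eq0 R).
have S_gt0 : 0 < #|S|%:R :> R by rewrite ltr0n card_gt0.
have X0 : 0 < X h by apply: lt_le_trans hX; rewrite mulr_gt0 // subr_gt0.
have XS : \sum_(s in S) (h s == c0)%:R = #|[set s in S | h s == c0]|%:R :> R.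
  by rewrite card_sep natr_sum.
have bad0 v : v \in T -> ~~ bad h v.
  move=> vT; apply/negP=> bv; move: X0; apply/negP; rewrite -leNgt subr_le0 XS.
  apply: (@le_trans _ _ #|S|%:R); first by rewrite ler_nat subset_leq_card //; apply/subsetP=> s; rewrite inE => /andP[].
  by rewrite ler_peMr // (bigD1 v) //= bv lerDl sumr_ge0.
exists h; split.
  move=> v /bad0; rewrite negb_forall => /existsP[u].
  by rewrite negb_imply negbK => /andP[uN /eqP hu]; exists u.
apply: le_trans hX _; rewrite -XS gerBl mulr_ge0 // sumr_ge0 //.
Qed.

End RandomAssignments.

(** * Attaching vertices to hubs *)

Section Hubs.
Variables (V : finType) (G : graph V) (r : nat) (f : coloring V r).

Lemma color_class_sub i (W : {set V}) v : v \in W -> color_class G f i W v \subset W.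
Proof.
move=> vW; apply/subsetP=> w; rewrite inE => /connectP[p]; elim/last_ind: p => [_ ->//|p z _].
by rewrite rcons_path last_rcons adj_color_graph => /andP[_ /and3P[_ _ zW]] ->.
Qed.

(** Each vertex of [S] can be attached to the tree of any colour in [C], whatever the choices made
    for the other vertices of [S]. *)
Definition hub (C : {set 'I_r}) (x : 'I_r -> V) (S : {set V}) :=
  forall i s, i \in C -> s \in S -> cadj G f i (x i) s.

(** The tree of colour [i] in [C] has depth at most two: the root [x i], then vertices of [S] given
    to [i] by [h], then outside vertices joined to those in colour [i]. The set [K] provides one
    further tree, in a colour outside [C]. *)
Lemma hub_trees (C : {set 'I_r}) (x : 'I_r -> V) (S K : {set V}) (h : V -> 'I_r) (i0 c0 : 'I_r) :
  hub C x S -> S != set0 -> i0 \in C ->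
  (K != set0 -> c0 \notin C /\ color_connected G f c0 K) ->
  (forall i, i \in C -> x i \notin K) ->
  (forall s, s \in S -> s \in K -> h s \notin C) ->
  exists HH : {set subgraph V},
    [/\ #|HH| <= r, forall H, H \in HH -> mono_tree G f H, vertex_disjoint HH &
      forall v, v \in uncovered HH ->
        [/\ v \notin K, v \notin S, v \notin x @: C
          & forall u, u \in S -> h u \in C -> ~~ cadj G f (h u) v u]].
Proof.
move=> hubS S0 i0C KP xK SK.
(* The colour of the tree containing [v], with priority to [K], then [S], then the roots. Vertices
   of [S] given a colour outside [C] go to the default [i0]. *)
pose g v : option 'I_r :=
  if v \in K then Some c0 else
  if v \in S then Some (if h v \in C then h v else i0) else
  if [pick i in C | x i == v] is Some i then Some i else
  if [pick u in S | (h u \in C) && cadj G f (h u) v u] is Some u then Some (h u) else None.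
pose W i := [set v | g v == Some i].
have gC v i : v \notin K -> g v = Some i -> i \in C.
  rewrite /g => /negbTE->; case: (v \in S).
    by case: ifP => [hC [<-]|_ [<-]].
  case: pickP => [j /andP[jC _] [<-] //|_].
  by case: pickP => [u /and3P[_ hC _] [<-]|].
have xS i : i \in C -> x i \notin S.
  by move=> iC; apply/negP=> /(hubS _ _ iC)/adj_neq; rewrite eqxx.
have [s0 s0S] := set0Pn _ S0.
have gx i : i \in C -> g (x i) = Some i.
  move=> iC; rewrite /g (negbTE (xK _ iC)) (negbTE (xS _ iC)).
  case: pickP => [j /andP[jC /eqP xji]|/(_ i)]; last by rewrite iC eqxx.
  (* Roots of different colours are distinct, since otherwise the edge from the common root to [s0]
     would have two colours. *)
  by congr Some; apply: (@cadj_inj _ G _ f _ _ (x j) s0); [|rewrite xji]; apply: hubS.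
have conW i : W i != set0 -> color_connected G f i (W i).
  have [iC|iC] := boolP (i \in C); last first.
    have WK v : v \in W i -> v \in K /\ i = c0.
      rewrite inE => /eqP gv; have [vK|vK] := boolP (v \in K).
        by move: gv; rewrite /g vK => -[].
      by move: iC; rewrite (gC _ _ vK gv).
    move=> Wi; have [v vW] := set0Pn _ Wi; have [vK ic0] := WK _ vW.
    have -> : W i = K.
      apply/setP=> w; apply/idP/idP=> [/WK[]//|wK].
      by rewrite inE /g wK ic0.
    by rewrite ic0; case: KP => //; apply/set0Pn; exists v.
  move=> Wi; apply/andP; split=> //.
  suff xW v : v \in W i -> connect (adj (color_graph G f i (W i))) (x i) v.
    apply/forall_inP=> v /xW xv; apply/forall_inP=> w /xW.
    by apply: connect_trans; rewrite adj_connect_sym.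
  have xi : x i \in W i by rewrite inE gx.
  move=> vW; have [vS|vS] := boolP (v \in S).
    by apply: connect1; rewrite adj_color_graph xi vW hubS.
  move: (vW); rewrite inE /g (negbTE vS).
  case: ifPn => [vK /eqP[ci]|vK].
    by case: KP; [apply/set0Pn; exists v|rewrite ci iC].
  case: pickP => [j /andP[jC /eqP<-] /eqP[->]|_]; first exact: connect0.
  case: pickP => [u /and3P[uS hC vu] /eqP[hu]|//].
  have uW : u \in W i.
    rewrite inE /g ifN; first by rewrite uS hC hu.
    by apply/negP=> /(SK _ uS); rewrite hC.
  apply: (@connect_trans _ _ u); apply: connect1; rewrite adj_color_graph ?xi uW ?vW.
    by rewrite hubS.
  by rewrite -hu cadj_sym vu.
have disW i j : i != j -> [disjoint W i & W j].
  move=> ij; apply/pred0P=> v; rewrite /= !inE; apply/negP=> /andP[/eqP-> /eqP[ij']].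
  by rewrite ij' eqxx in ij.
have [HH [cH tH dH uH]] := disjoint_tree_family disW conW.
exists HH; split=> //; first by rewrite card_ord in cH.
move=> v; rewrite uH inE => /bigcupP vW.
have {vW} gv i : g v <> Some i by move=> gvi; case: vW; exists i; rewrite // inE gvi.
have vK : v \notin K by apply/negP=> vK; apply: (gv c0); rewrite /g vK.
have vS : v \notin S.
  by apply/negP=> vS; move: (gv); rewrite /g (negbTE vK) vS => /(_ _ erefl).
split=> //.
  by apply/imsetP=> -[i iC vx]; apply: (gv i); rewrite vx gx.
move=> u uS hC; apply/negP=> vu; move: gv; rewrite /g (negbTE vK) (negbTE vS).
case: pickP => [i _ /(_ _ erefl)//|_]; case: pickP => [w _ /(_ _ erefl) //|/(_ u)].
by rewrite uS hC vu.
Qed.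

Lemma trees_partition (HH : {set subgraph V}) (k : nat) :
  #|HH| <= k -> (forall H, H \in HH -> mono_tree G f H) -> vertex_disjoint HH ->
  uncovered HH = set0 ->
  [exists HH : {set subgraph V}, [&& #|HH| <= k, [forall H in HH, mono_connected G f H]
      & partition (vertex_sets HH) [set: V]]].
Proof.
move=> cH tH dH uH; apply/existsP; exists HH; apply/and3P; split=> //.
  by apply/forall_inP=> H /tH[].
apply/and3P; split.
- by rewrite -[cover _]setCK -/(uncovered HH) uH setC0.
- apply/trivIsetP=> _ _ /imsetP[H HH1 ->] /imsetP[H' HH2 ->] neqH.
  by apply: dH => //; apply: contraNneq neqH => ->.
- by apply/imsetP=> -[H /tH[/and3P[_ _ /andP[H0 _]] _] H0']; rewrite -H0' eqxx in H0.
Qed.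

Lemma two_classes_partition (i : 'I_r) (u v : V) :
  (forall w, connect (cadj G f i) u w || connect (cadj G f i) v w) ->
  [exists HH : {set subgraph V}, [&& #|HH| <= 2, [forall H in HH, mono_connected G f H]
      & partition (vertex_sets HH) [set: V]]].
Proof.
move=> uv.
(* If both classes coincide, the second piece is left empty. *)
pose W b := if b then color_class G f i setT u else
  if connect (cadj G f i) u v then set0 else color_class G f i setT v.
have [||HH [cH tH dH uH]] := @disjoint_tree_family _ G _ f _ W (fun=> i).
- suff dW : [disjoint W true & W false] by move=> [] [] //= _; rewrite disjoint_sym.
  rewrite /W; case: ifPn => uv'; first by rewrite -setI_eq0 setI0.
  apply/pred0P=> w; rewrite /= !inE; apply/negP=> /andP[uw]; rewrite adj_connect_sym.
  by move/(connect_trans uw); apply/negP.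
- case=> /=; first by rewrite color_class_connected.
  by case: ifP; rewrite ?eqxx // color_class_connected.
apply: trees_partition tH dH _; first by rewrite card_bool in cH.
rewrite uH; apply/setP=> w; rewrite !inE; apply/negbTE; rewrite negbK.
apply/bigcupP; case/orP: (uv w) => [uw|vw]; first by exists true; rewrite // inE.
have [uv'|uv'] := boolP (connect (cadj G f i) u v).
  by exists true; rewrite // inE (connect_trans uv').
by exists false; rewrite //= (negbTE uv') inE.
Qed.

End Hubs.

(* Vertices are edges of a bipartite graph between the red and the blue
   components; this is Koenig's theorem for matching number at most two. *)
Lemma two_components_cover (T : finType) (A : eqType) (rho beta : T -> A) (x0 : T) :
  (forall u v w, [|| rho u == rho v, rho u == rho w, rho v == rho w,
     beta u == beta v, beta u == beta w | beta v == beta w]) ->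
  [\/ exists u v, forall w, (rho u == rho w) || (rho v == rho w),
      exists u v, forall w, (beta u == beta w) || (beta v == beta w)
    | exists u v, forall w, (rho u == rho w) || (beta v == beta w)].
Proof.
move=> meet.
have [/existsP[u /existsP[v /forallP uv]]|] :=
  boolP [exists u, exists v, forall w, (rho u == rho w) || (rho v == rho w)].
  by constructor 1; exists u, v.
have [/existsP[u /existsP[v /forallP uv]]|] :=
  boolP [exists u, exists v, forall w, (beta u == beta w) || (beta v == beta w)].
  by constructor 2; exists u, v.
move=> beta3 rho3; constructor 3.
have {}beta3 u v : exists w, beta u <> beta w /\ beta v <> beta w.
  move: beta3; rewrite negb_exists => /forallP/(_ u); rewrite negb_exists => /forallP/(_ v).
  rewrite negb_forall => /existsP[w]; rewrite negb_or => /andP[/eqP ? /eqP ?].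
  by exists w.
have {}rho3 u v : exists w, rho u <> rho w /\ rho v <> rho w.
  move: rho3; rewrite negb_exists => /forallP/(_ u); rewrite negb_exists => /forallP/(_ v).
  rewrite negb_forall => /existsP[w]; rewrite negb_or => /andP[/eqP ? /eqP ?].
  by exists w.
have {}meet u v w : [\/ rho u = rho v, rho u = rho w | rho v = rho w] \/
    [\/ beta u = beta v, beta u = beta w | beta v = beta w].
  by case/or4P: (meet u v w) => [||| /or3P[]] /eqP ->; [left;constructor 1|left; constructor 2|left;constructor 3|right; constructor 1|right; constructor 2|right;constructor 3].
(* Two vertices differing in both components, that is, a matching of size two. *)
have [a [b [rab bab]]] : exists a b, rho a <> rho b /\ beta a <> beta b.
  have [w [uw _]] := rho3 x0 x0.
  have [E|?] := eqVneq (beta x0) (beta w); last by exists x0, w; split=> //; apply/eqP.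
  have [z [uz _]] := beta3 x0 x0.
  have [Ez|?] := eqVneq (rho x0) (rho z); last by exists x0, z; split=> //; apply/eqP.
  by exists z, w; split; congruence.
(* [w] lies in a third red component and [z] in a third blue one. By [meet], [w] shares its blue
   component with [a] or [b]; up to exchanging these, it is [a]. *)
have [w [aw bw]] := rho3 a b; have [z [az bz]] := beta3 a b.
wlog bwa : a b rab bab aw bw az bz / beta w = beta a.
  move=> main; have [|wa] := eqVneq (beta w) (beta a); first by move=> E; apply: (main a b).
  apply: (main b a) => //; try congruence.
  by move/eqP: wa => wa; case: (meet a b w) => [[]|[]] ?; congruence.
have zb : rho z = rho b by case: (meet w z b) (meet a b z) => [[]|[]] ? [[]|[]] ?; congruence.
exists b, a => v.
case: eqP => //= bv; case: eqP => //= av; exfalso.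
by move: (meet a b v) (meet w z v) (meet v w b) (meet a z v) => [[]|[]] ? [[]|[]] ? [[]|[]] ? [[]|[]] ?; congruence.
Qed.

(** * Partition into two trees for two colours *)

Definition common_nbrs (V : finType) (G : graph V) (M : {set V}) : {set V} :=
  [set z | [forall u in M, adj G z u]].

(** The numerical hypothesis makes the expected number of vertices that a random splitting attaches
    to neither side smaller than 1/2. *)
Lemma tree_partition_number_le2 (V : finType) (G : graph V) :
  2 < #|V| ->
  (forall M : {set V}, #|M| = 3 -> 2 * #|V| < 2 ^ #|common_nbrs G M|) ->
  tp 2 G <= 2.
Proof.
move=> V_gt2 comG; have /card_gt0P[x0 _] : 0 < #|V| by lia.
rewrite /tp; case: ex_minnP => s _; apply.
apply/forallP=> f; pose red : 'I_2 := ord0; pose blue : 'I_2 := ord_max.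
have color2 (i : 'I_2) : i = red \/ i = blue.
  by case: i => [[|[|//]] i2]; [left|right]; apply: val_inj.
pose rho (x : V) := fingraph.root (cadj G f red) x.
pose beta (x : V) := fingraph.root (cadj G f blue) x.
have rhoE x y : (rho x == rho y) = connect (cadj G f red) x y by apply/root_connect/adj_connect_sym.
have betaE x y : (beta x == beta y) = connect (cadj G f blue) x y by apply/root_connect/adj_connect_sym.
clearbody rho beta.
have edge x y : adj G x y -> rho x = rho y \/ beta x = beta y.
  move=> /(adj_cadj f)[i]; case: (color2 i) => -> /connect1.
    by rewrite -rhoE => /eqP; left.
  by rewrite -betaE => /eqP; right.
have [|[u [v uv]]|[u [v uv]]|[u [v uv]]] := @two_components_cover V V rho beta x0.
(* A common neighbour sends three edges in two colours to three distinct vertices, so two of these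
   share a component. *)
- move=> u v w.
  have [->|uv] := eqVneq u v; first by rewrite eqxx.
  have [->|uw] := eqVneq u w; first by rewrite eqxx ?orbT.
  have [->|vw] := eqVneq v w; first by rewrite eqxx ?orbT.
  have cM : #|[set u; v; w]| = 3 by rewrite setUC cardsU1 cards2 !inE uv negb_or ![w == _]eq_sym uw vw.
  have /card_gt0P[z] : 0 < #|common_nbrs G [set u; v; w]|.
    have V_gt0 : 0 < #|V| by apply/card_gt0P; exists x0.
    by have := comG _ cM; case: #|common_nbrs _ _| => //; rewrite expn0; lia.
  rewrite inE => /forall_inP zM.
  have [uM vM wM] : [/\ u \in [set u; v; w], v \in [set u; v; w] & w \in [set u; v; w]].
    by rewrite !inE !eqxx !orbT.
  by case: (edge _ _ (zM u uM)) => <-; case: (edge _ _ (zM v vM)) => <-;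
     case: (edge _ _ (zM w wM)) => <-; rewrite eqxx ?orbT.
- by apply: (@two_classes_partition _ G _ f red u v) => w; rewrite -!rhoE.
- by apply: (@two_classes_partition _ G _ f blue u v) => w; rewrite -!betaE.
have [/forallP rw|] := boolP [forall w, rho u == rho w].
  by apply: (@two_classes_partition _ G _ f red u u) => w; rewrite -!rhoE rw.
have [/forallP bw _|] := boolP [forall w, beta v == beta w].
  by apply: (@two_classes_partition _ G _ f blue v v) => w; rewrite -!betaE bw.
(* [x] lies only in the red component of [u], and [y] only in the blue component of [v]. *)
rewrite !negb_forall => /existsP[x bx] /existsP[y ry].
have rx : rho u == rho x by move: (uv x); rewrite (negbTE bx) orbF.
have by_ : beta v == beta y by move: (uv y); rewrite (negbTE ry).
have xy : x != y by apply: contraNneq ry => <-.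
pose S := common_nbrs G [set x; y].
(* As [t] lies in one of the two covering components, any other colouring of its edges to [x] and
   [y] would put [x] in the blue one or [y] in the red one. *)
have SP t : t \in S -> cadj G f red x t /\ cadj G f blue y t.
  rewrite inE => /forall_inP txy.
  have redE a b : cadj G f red a b -> rho a = rho b by move/connect1; rewrite -rhoE => /eqP.
  have blueE a b : cadj G f blue a b -> beta a = beta b by move/connect1; rewrite -betaE => /eqP.
  have /(adj_cadj f)[i tx] := txy x (set21 _ _); have /(adj_cadj f)[j ty] := txy y (set22 _ _).
  move/eqP: bx ry rx by_ (uv t) => bx /eqP ry /eqP rx /eqP by_ /orP uvt.
  rewrite ![cadj _ _ _ _ t]cadj_sym.
  have same a k : cadj G f k t a -> (k = red /\ rho t = rho a) \/ (k = blue /\ beta t = beta a).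
    by case: (color2 k) => -> => [/redE|/blueE]; auto.
  have Ex := same _ _ tx; have Ey := same _ _ ty; move: tx ty.
  by case: Ex Ey => -[-> Ex] [] [-> Ey] tx ty;
     case: uvt => /eqP E; split => //; congruence.
have V_gt0 : (0 < #|V|%:R :> rat)%R by rewrite ltr0n; apply/card_gt0P; exists x.
have card3 w : w \in ~: [set x; y] -> #|[set x; y; w]| = 3.
  by rewrite inE => wxy; rewrite setUC cardsU1 wxy cards2 xy.
have q1 : (\sum_(w in ~: [set x; y] :\: S) (1 - 2%:R^-1) ^+ #|common_nbrs G [set x; y; w]| < 2%:R^-1 :> rat)%R.
  apply: (@lt_le_trans _ _ (\sum_(w : V) 2%:R^-1 / #|V|%:R)%R); last first.
    by rewrite sumr_uniform // (leq_trans _ V_gt2).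
  rewrite big_mkcond /=; apply: ltr_sum => [|w _]; first by apply/hasP; exists x; rewrite ?mem_index_enum.
  case: ifP => [|_]; last by rewrite divr_gt0.
  rewrite in_setD => /andP[_ /card3/comG].
  rewrite (_ : 1 - 2%:R^-1 = 2%:R^-1)%R // -invfM exprVn ltf_pV2 ?posrE ?exprn_gt0 ?mulr_gt0 //.
  by rewrite -natrM -natrX ltr_nat.
have S0 : S != set0.
  apply/set0Pn; have /card_gt0P[w] : 0 < #|~: [set x; y]|.
    by have := cardsC [set x; y]; rewrite cards2 xy; lia.
  rewrite inE => wxy.
  have := comG _ (card3 w _); rewrite inE => /(_ wxy).
  have [->|[t]] := set_0Vmem (common_nbrs G [set x; y; w]).
    by rewrite cards0 expn0; move: V_gt0; rewrite ltr0n; lia.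
  by rewrite inE => /forall_inP tw _; exists t; rewrite inE; apply/forall_inP=> a axy; apply: tw; rewrite inE axy.
(* The target colour of [t] for [w] is the colour of the edge [wt]; [red] is a default for
   non-edges. *)
have [||h [hT _]] := @exists_assignment rat V 2 (~: [set x; y] :\: S) S (fun w => common_nbrs G [set x; y; w])
  (fun w t => odflt red [pick i | cadj G f i w t]) red.
- exact: q1.
- exact: S0.
pose hx (i : 'I_2) := if i == red then x else y.
have [||||||HH [cH tH dH uH]] := @hub_trees V G 2 f setT hx S set0 h red red.
- move=> i t _ /SP[xt yt]; rewrite /hx; case: eqP => [-> //|]; by case: (color2 i) => ->.
- exact: S0.
- by rewrite inE.
- by rewrite eqxx.
- by move=> i _; rewrite inE.
- by move=> t _; rewrite inE.
apply: trees_partition cH tH dH _; apply/setP=> w; rewrite [in RHS]inE; apply/negP=> /uH[_ wS wh nh].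
have [|t] := hT w.
  rewrite in_setD wS !inE /= negb_or; apply/andP; split; apply: contraNneq wh => ->.
    by apply/imsetP; exists red; rewrite // /hx eqxx.
  by apply/imsetP; exists blue.
rewrite inE => /forall_inP tw ht.
have tS : t \in S by rewrite inE; apply/forall_inP=> a axy; apply: tw; rewrite inE axy.
have /negP := nh t tS (in_setT _); apply; rewrite ht.
have wM : w \in [set x; y; w] by rewrite !inE eqxx orbT.
case: pickP => [//|]; have /(adj_cadj f)[i] := tw w wM.
by rewrite cadj_sym => wt /(_ i); rewrite wt.
Qed.

(** * Few disjoint trees covering almost everything *)

Local Open Scope ring_scope.

Section Sparse.
Variables (R : realFieldType) (V : finType) (G : graph V) (r : nat) (f : coloring V r).
Variables (p L : R).

Definition nbrs_in (v : V) (D : {set V}) : {set V} := [set u in D | adj G v u].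

(** Disjoint sets that are not too small span more than one eighth of the expected number of edges;
    [L] will be [ln n]. *)
Definition jumbled := forall A D : {set V}, [disjoint A & D] ->
  8 * L / p <= #|A|%:R -> 16 * L / p <= #|D|%:R ->
  p * #|A|%:R * #|D|%:R / 8 < (\sum_(a in A) #|nbrs_in a D|)%:R.

Hypotheses (r_ge2 : (2 <= r)%N) (p_gt0 : 0 < p) (p_le1 : p <= 1) (L_gt0 : 0 < L) (jG : jumbled).
Hypothesis random_fail : forall m : nat, 2 * r%:R * L <= m%:R ->
  #|V|%:R * (1 - r%:R^-1) ^+ m <= (2 * r%:R)^-1 :> R.

Definition few_trees := exists HH : {set subgraph V},
  [/\ (#|HH| <= r)%N, forall H, H \in HH -> mono_tree G f H, vertex_disjoint HH
    & #|uncovered HH|%:R <= 16 * L / p].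

Let r_gt0 : 0 < r%:R :> R. Proof. by rewrite ltr0n (leq_trans _ r_ge2). Qed.
Let r_ge2R : 2 <= r%:R :> R. Proof. by rewrite ler_nat. Qed.

(** A random splitting of [S] catches every vertex with at least [2 * r * L] neighbours in [S] in
    colours of [C]. Failures cost at most [1/(2r)] in expectation, so the class of [c0] keeps half
    of its expected size [#|S| / r]. *)
Lemma assignment_or_few_nbrs (C : {set 'I_r}) (S : {set V}) (c0 : 'I_r) : S != set0 ->
  exists h : V -> 'I_r,
    #|S|%:R / (2 * r%:R) <= #|[set s in S | h s == c0]|%:R :> R /\
    forall v, (forall u, u \in S -> h u \in C -> ~~ cadj G f (h u) v u) ->
      #|[set u in S | [exists i in C, cadj G f i v u]]|%:R < 2 * r%:R * L :> R.
Proof.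
move=> S0; pose N v := [set u in S | [exists i in C, cadj G f i v u]].
pose c v u := odflt c0 [pick i in C | cadj G f i v u].
pose T := [set v | 2 * r%:R * L <= #|N v|%:R].
have qle : \sum_(v in T) (1 - r%:R^-1) ^+ #|N v| <= (2 * r%:R)^-1 :> R.
  have V0 : 0 < #|V|%:R :> R.
    by have [s _] := set0Pn _ S0; rewrite ltr0n; apply/card_gt0P; exists s.
  rewrite -[leRHS](@sumr_uniform _ V) -?(ltr0n R) //.
  rewrite big_mkcond; apply: ler_sum => v _; case: ifP => [|_].
    by rewrite inE => /random_fail; rewrite ler_pdivlMr // mulrC.
  by rewrite divr_ge0 ?invr_ge0 ?mulr_ge0 ?ltW.
have half : (2 * r%:R)^-1 = r%:R^-1 / 2 :> R by rewrite invfM mulrC.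
have rV0 : 0 < r%:R^-1 :> R by rewrite invr_gt0.
have [|//|h [hT hS]] := @exists_assignment R V r T S N c c0.
  by apply: le_lt_trans qle _; rewrite half; (move: L_gt0 p_gt0 p_le1 r_ge2R r_gt0; lra).
exists h; split.
  apply: le_trans hS; rewrite ler_wpM2l //; move: qle; rewrite half; (move: L_gt0 p_gt0 p_le1 r_ge2R r_gt0; lra).
move=> v nov; rewrite ltNge; apply/negP=> vT.
have [|u] := hT v; first by rewrite inE.
rewrite inE => /andP[uS /exists_inP[i iC viu]] huc.
have : h u \in C /\ cadj G f (h u) v u.
  by rewrite huc /c; case: pickP => [j /andP[]//|/(_ i)]; rewrite iC viu.
by case=> huC; apply/negP/nov.
Qed.

Definition uncaught (C : {set 'I_r}) (x : 'I_r -> V) (S : {set V}) (h : V -> 'I_r) :=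
  [set v | [&& v \notin S, v \notin x @: C
           & [forall u in S, (h u \in C) ==> ~~ cadj G f (h u) v u]]].

(** If no vertex sends many edges to [S] in a new colour, then every uncaught vertex has at most
    [p * #|S| / 8] neighbours in [S], and [jumbled] bounds the number of such vertices. *)
Lemma hub_step (C : {set 'I_r}) (x : 'I_r -> V) (S : {set V}) :
  hub G f C x S -> 64 * r%:R ^+ 2 * L <= p * #|S|%:R ->
  (C = set0 -> 8 * L / p <= #|~: S|%:R) ->
  few_trees \/
  exists c v, c \notin C /\
    p / (16 * r%:R) * #|S|%:R <= #|[set s in S | cadj G f c v s]|%:R.
Proof.
move=> hubS bigS CS.
have r2L : 4 * L <= r%:R ^+ 2 * L by rewrite ler_pM2r // expr2; have := r_ge2R; nra.
have rrL : 2 * (r%:R * L) <= r%:R ^+ 2 * L by rewrite expr2 mulrA ler_pM2r // ler_pM2r.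
have S_gt0 : 0 < #|S|%:R :> R by rewrite -(pmulr_rgt0 _ p_gt0); apply: lt_le_trans bigS; rewrite !mulr_gt0 ?exprn_gt0.
have S0 : S != set0 by rewrite -card_gt0 -(ltr0n R).
have [/existsP[c /existsP[v /andP[cC cv]]]|] := boolP [exists c, exists v, (c \notin C) &&
    (p / (16 * r%:R) * #|S|%:R <= #|[set s in S | cadj G f c v s]|%:R :> R)].
  by right; exists c, v.
rewrite negb_exists => /forallP nbig; left.
have {}nbig c v : c \notin C -> #|[set s in S | cadj G f c v s]|%:R < p / (16 * r%:R) * #|S|%:R :> R.
  move=> cC; have := nbig c; rewrite negb_exists => /forallP/(_ v).
  by rewrite cC /= -ltNge.
have c0 : 'I_r := Ordinal (leq_trans (isT : (0 < 2)%N) r_ge2).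
have [h [_ hfew]] := @assignment_or_few_nbrs C S c0 S0.
set U := uncaught C x S h.
have degU v : v \in U -> #|nbrs_in v S|%:R <= 2 * r%:R * L + p / 16 * #|S|%:R.
  rewrite inE => /and3P[vS vx /forall_inP vh].
  have /hfew/ltW few : forall u, u \in S -> h u \in C -> ~~ cadj G f (h u) v u.
    by move=> u uS; apply/implyP/vh.
  have sub : (#|nbrs_in v S| <= #|[set u in S | [exists i in C, cadj G f i v u]]|
      + \sum_(c in ~: C) #|[set u in S | cadj G f c v u]|)%N.
    under eq_bigr do rewrite card_sep.
    rewrite exchange_big !card_sep /= -big_split; apply: leq_sum => u _.
    have [/(adj_cadj f)[i vu]|//] := boolP (adj G v u).
    have [iC|iC] := boolP (i \in C).
      by rewrite (introT exists_inP) //; exists i.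
    apply: (@leq_trans (\sum_(c in ~: C) cadj G f c v u)%N); last exact: leq_addl.
    by rewrite (bigD1 i) ?inE //= vu.
  move: few sub; set n1 := #|_|; set n2 := (\sum_(c in _) _)%N => few sub.
  apply: (@le_trans _ _ (n1 + n2)%:R); first by rewrite ler_nat.
  rewrite natrD lerD // natr_sum.
  apply: le_trans (ler_sum _ (G := fun=> p / (16 * r%:R) * #|S|%:R) _) _.
    by move=> c; rewrite inE => cC; apply/ltW/nbig.
  rewrite sumr_const -[leLHS]mulr_natr mulrAC ler_pM2r //.
  have -> : p / 16 = p / (16 * r%:R) * r%:R by field; rewrite gt_eqF.
  rewrite ler_pM2l ?divr_gt0 ?mulr_gt0 // ler_nat -[leqRHS](card_ord r); exact: max_card.
have Usmall : #|U|%:R < 8 * L / p.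
  rewrite ltNge; apply/negP=> Ubig.
  have dUS : [disjoint U & S].
    by apply/pred0P=> v; rewrite /= inE; case: (v \in S); rewrite ?andbF.
  have bigS' : 16 * L / p <= #|S|%:R by rewrite ler_pdivrMr // mulrC; (move: L_gt0 p_gt0 p_le1 r_ge2R r_gt0; lra).
  have := jG dUS Ubig bigS'; apply/negP; rewrite -leNgt natr_sum.
  apply: le_trans (ler_sum _ degU) _; rewrite sumr_const -[leLHS]mulr_natr.
  have -> : p * #|U|%:R * #|S|%:R / 8 = (p * #|S|%:R / 8) * #|U|%:R :> R by ring.
  rewrite ler_wpM2r //; (move: L_gt0 p_gt0 p_le1 r_ge2R r_gt0; lra).
(* Without roots every vertex outside [S] is uncaught, and there are too many of these by [CS]. *)
have [C0|[i0 i0C]] := set_0Vmem C.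
  move: Usmall; rewrite ltNge => /negP[]; apply: le_trans (CS C0) _.
  rewrite ler_nat subset_leq_card //; apply/subsetP=> v; rewrite !inE => ->.
  rewrite C0 imset0 inE /=; apply/forall_inP=> u _; by rewrite inE.
have [|||HH [cH tH dH uH]] := @hub_trees V G r f C x S set0 h i0 c0 hubS S0 i0C.
- by rewrite eqxx.
- by move=> i _; rewrite inE.
- by move=> s _; rewrite inE.
exists HH; split=> //; apply: (@le_trans _ _ #|U|%:R); last first.
  by apply/ltW/(lt_le_trans Usmall); rewrite ler_pM2r ?invr_gt0 // ler_pM2r // ler_nat.
rewrite ler_nat subset_leq_card //; apply/subsetP=> v /uH[_ vS vx vh].
by rewrite inE vS vx; apply/forall_inP=> u uS; apply/implyP/vh.
Qed.

(** Take a maximal union [A] of classes in [U] with fewer than [m] elements, and add the class [K]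
    of a further vertex. By maximality the result is no longer small, so its complement in [U] is,
    and [U :\: K] is covered by two small sets. *)
Lemma unsplittable_class (e : rel V) (U : {set V}) (m : R) :
  connect_sym e -> 0 < m ->
  (forall A : {set V}, A \subset U ->
    (forall a b, a \in A -> b \in U -> connect e a b -> b \in A) ->
    #|A|%:R < m \/ #|U :\: A|%:R < m) ->
  exists2 K : {set V}, K = set0 \/ (exists2 v, v \in U & K = [set w | connect e v w])
    & #|U :\: K|%:R < 2 * m.
Proof.
move=> syme m_gt0 split.
pose small (A : {set V}) := [&& A \subset U, [forall a in A, forall b in U, connect e a b ==> (b \in A)]
  & #|A|%:R < m].
have small0 : small set0.
  by rewrite /small sub0set cards0 m_gt0 andbT; apply/forall_inP=> a; rewrite inE.
have [A /maxsetP[/and3P[subA /forall_inP clA ltA] maxA] _] := maxset_exists small0.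
have [UA|[v]] := set_0Vmem (U :\: A).
  exists set0; first by left.
  rewrite setD0; apply: (@le_lt_trans _ _ #|A|%:R); last by (move: L_gt0 p_gt0 p_le1 r_ge2R r_gt0; lra).
  by rewrite ler_nat subset_leq_card // -setD_eq0 UA.
rewrite inE => /andP[vA vU]; pose K := [set w | connect e v w].
exists K; first by right; exists v.
pose B := A :|: (U :&: K).
have subB : B \subset U by rewrite subUset subA subsetIl.
have clB a b : a \in B -> b \in U -> connect e a b -> b \in B.
  rewrite !inE => /orP[aA|/andP[aU va]] bU ab.
    by rewrite (implyP (forall_inP (clA a aA) b bU) ab).
  by rewrite bU (connect_trans va ab) orbT.
have UKB : (#|U :\: K| <= #|A| + #|U :\: B|)%N.
  apply: leq_trans (leq_card_setU _ _); apply/subset_leq_card/subsetP=> w.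
  by rewrite !inE => /andP[/negbTE-> ->]; rewrite andbF orbF andbT orbN.
have [ltB|ltUB] := split B subB clB.
  have /maxA/(_ (subsetUl _ _)) BA : small B.
    rewrite /small subB ltB andbT; apply/forall_inP=> a aB; apply/forall_inP=> b bU.
    by apply/implyP; apply: clB.
  by rewrite -BA !inE vU connect0 orbT in vA.
apply: (@le_lt_trans _ _ (#|A| + #|U :\: B|)%:R); first by rewrite ler_nat.
by rewrite natrD; (move: L_gt0 p_gt0 p_le1 r_ge2R r_gt0; lra).
Qed.

(** Only [c0] has no root. The part of [S] that [h] gives to [c0] serves to connect almost all
    uncaught vertices in colour [c0]. *)
Lemma hub_last (c0 : 'I_r) (x : 'I_r -> V) (S : {set V}) :
  hub G f [set~ c0] x S -> 64 * r%:R ^+ 2 * L <= p * #|S|%:R -> few_trees.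
Proof.
move=> hubS bigS; set C := [set~ c0].
have r2L : 4 * L <= r%:R ^+ 2 * L by rewrite ler_pM2r // expr2; have := r_ge2R; nra.
have rrL : 2 * (r%:R * L) <= r%:R ^+ 2 * L by rewrite expr2 mulrA ler_pM2r // ler_pM2r.
have S_gt0 : 0 < #|S|%:R :> R by rewrite -(pmulr_rgt0 _ p_gt0); apply: lt_le_trans bigS; rewrite !mulr_gt0 ?exprn_gt0.
have S0 : S != set0 by rewrite -card_gt0 -(ltr0n R).
have [i0 i0C] : exists i0, i0 \in C.
  apply/card_gt0P; have := cardsC1 c0;
  by rewrite card_ord => ->; case: (r) r_ge2 => [|[]].
have [h [hS hfew]] := @assignment_or_few_nbrs C S c0 S0.
set U := uncaught C x S h; set S0c := [set s in S | h s == c0] in hS.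
have xS i : i \in C -> x i \notin S.
  by move=> iC; apply/negP=> /(hubS _ _ iC)/adj_neq; rewrite eqxx.
(* Otherwise at least half of [S0c], called [E], receives no edge of colour [c0] from [B]. Each
   vertex of [B] then has fewer than [2 * r * L <= p * #|E| / 8] neighbours in [E], against
   [jumbled]. *)
have half_seen (B : {set V}) : B \subset U -> 8 * L / p <= #|B|%:R ->
    (#|S0c| < 2 * #|[set s in S0c | [exists b in B, cadj G f c0 b s]]|)%N.
  move=> subB bigB; set D := [set s in _ | _]; rewrite ltnNge; apply/negP=> leD.
  pose E := S0c :\: D.
  have cE : (#|S0c| <= 2 * #|E|)%N.
    by have := cardsID D S0c; rewrite -/E (setIidPr _) //; [move: leD; clear; lia|apply/subsetP=> s; rewrite inE => /andP[]].
  have pE : 16 * (r%:R * L) <= p * #|E|%:R.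
    have : #|S0c|%:R <= 2 * #|E|%:R :> R by rewrite -natrM ler_nat.
    move=> /(le_trans hS); rewrite ler_pdivrMr ?mulr_gt0 // => cSE.
    have : p * #|S|%:R <= p * (2 * #|E|%:R * (2 * r%:R)) by rewrite ler_pM2l.
    move=> /(le_trans bigS); rewrite (_ : 64 * r%:R ^+ 2 * L = 4 * r%:R * (16 * (r%:R * L))); last by ring.
    rewrite (_ : p * (2 * #|E|%:R * (2 * r%:R)) = 4 * r%:R * (p * #|E|%:R)); last by ring.
    by rewrite ler_pM2l // mulr_gt0.
  have bigE : 16 * L / p <= #|E|%:R.
    rewrite ler_pdivrMr // [leRHS]mulrC; apply: le_trans pE; rewrite ler_pM2l //.
    by rewrite ler_peMl ?ltW //; (move: L_gt0 p_gt0 p_le1 r_ge2R r_gt0; lra).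
  have ES s : s \in E -> s \in S by rewrite !inE => /and3P[].
  have dBE : [disjoint B & E].
    apply/pred0P=> v; apply/negP=> /andP[/(subsetP subB)]; rewrite inE => /andP[vS _] /ES.
    exact/negP.
  have := jG dBE bigB bigE; apply/negP; rewrite -leNgt natr_sum.
  apply: (@le_trans _ _ (\sum_(b in B) 2 * r%:R * L)).
    apply: ler_sum => b bB; apply: (@le_trans _ _ #|[set u in S | [exists i in C, cadj G f i b u]]|%:R).
      rewrite ler_nat subset_leq_card //; apply/subsetP=> u.
      rewrite [u \in nbrs_in _ _]inE => /andP[uE /(adj_cadj f)[i bu]].
      rewrite inE (ES _ uE) /=; apply/exists_inP; exists i => //.
      rewrite !inE; apply/negP=> /eqP ic0; move: uE.
      rewrite in_setD => /andP[/negP uD uS0]; apply: uD.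
      by rewrite inE uS0 /=; apply/exists_inP; exists b; rewrite // -ic0.
    apply/ltW/hfew=> u uS.
    have := subsetP subB b bB; rewrite inE => /and3P[_ _ /forall_inP bh].
    by apply/implyP/bh.
  rewrite sumr_const -[leLHS]mulr_natr.
  have -> : p * #|B|%:R * #|E|%:R / 8 = (p * #|E|%:R / 8) * #|B|%:R :> R by ring.
  rewrite ler_wpM2r //; (move: L_gt0 p_gt0 p_le1 r_ge2R r_gt0; lra).
(* Components are taken inside [Z], so that [K] avoids the roots and the vertices of [S] given to
   other colours. *)
pose Z := U :|: S0c.
have [||A subA clA|K Kclass Usmall] := @unsplittable_class (adj (color_graph G f c0 Z)) U (8 * L / p).
- exact: adj_connect_sym.
- by rewrite divr_gt0 ?mulr_gt0.
(* Two large parts of [U] each see more than half of [S0c], hence have a common neighbour there in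
   colour [c0]. *)
- rewrite !ltNge; apply/orP; rewrite -negb_and; apply/negP=> /andP[bigA bigA'].
  have := half_seen _ subA bigA; have := half_seen _ (subsetDl _ _) bigA'.
  set D := [set s in _ | _]; set D' := [set s in _ | _] => ltD ltD'.
  have dDD : [disjoint D' & D].
    apply/pred0P=> s; rewrite /= !inE; apply/negP=> /andP[/andP[sS /exists_inP[a aA as_]]].
    case/andP=> _ /exists_inP[b]; rewrite inE => /andP[bA bU] bs; move: bA; apply/negP; rewrite negbK.
    have sZ : s \in Z by rewrite !inE sS orbT.
    have UZ v : v \in U -> v \in Z by rewrite [v \in Z]inE => ->.
    apply: (clA a b aA bU); apply: (@connect_trans _ _ s); apply: connect1.
      by rewrite adj_color_graph as_ sZ UZ // (subsetP subA).
    by rewrite adj_color_graph cadj_sym bs sZ UZ.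
  have : (#|D' :|: D| <= #|S0c|)%N.
    by apply/subset_leq_card/subsetP=> s; rewrite !inE => /orP[] /andP[/andP[-> ->]].
  by rewrite cardsU disjoint_setI0 // cards0; move: ltD ltD'; clear; lia.
have KZ : K \subset Z.
  case: Kclass => [->|[v vU ->]]; first exact: sub0set.
  by apply: color_class_sub; rewrite inE vU.
have [|||HH [cH tH dH uH]] := @hub_trees V G r f C x S K h i0 c0 hubS S0 i0C.
- case: Kclass => [->|[v vU KE] _]; first by rewrite eqxx.
  split; first by rewrite !inE eqxx.
  by rewrite KE; apply: color_class_connected.
- move=> i iC; apply/negP=> /(subsetP KZ); rewrite !inE (negbTE (xS i iC)) /= orbF.
  by rewrite imset_f.
- move=> s sS /(subsetP KZ); rewrite !inE sS /= => /eqP->.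
  by rewrite eqxx.
exists HH; split=> //; apply: (@le_trans _ _ #|U :\: K|%:R); last first.
  by apply: (ltW (lt_le_trans Usmall _)); rewrite mulrA mulrA -natrM.
rewrite ler_nat subset_leq_card //; apply/subsetP=> v /uH[vK vS vx vh].
by rewrite !inE vK vS vx; apply/forall_inP=> u uS; apply/implyP/vh.
Qed.

Lemma few_trees_exist (s0 : R) :
  64 * r%:R ^+ 2 * L <= p * (s0 * (p / (16 * r%:R)) ^+ r.-1) ->
  (exists2 S : {set V}, s0 <= #|S|%:R & 8 * L / p <= #|~: S|%:R) -> few_trees.
Proof.
move=> big [S sS bigS].
have q_gt0 : 0 < p / (16 * r%:R) by rewrite divr_gt0 ?mulr_gt0.
have s0_gt0 : 0 < s0.
  rewrite -(pmulr_lgt0 _ (exprn_gt0 r.-1 q_gt0)) -(pmulr_rgt0 _ p_gt0).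
  by apply: lt_le_trans big; rewrite !mulr_gt0 ?exprn_gt0.
have bigk k : (k <= r.-1)%N -> 64 * r%:R ^+ 2 * L <= p * (s0 * (p / (16 * r%:R)) ^+ k).
  move=> kr; apply: le_trans big _; rewrite ler_pM2l // ler_pM2l //.
  have q1 : 0 <= p / (16 * r%:R) <= 1.
    by rewrite (ltW q_gt0) /= ler_pdivrMr ?mulr_gt0 //; (move: L_gt0 p_gt0 p_le1 r_ge2R r_gt0; lra).
  by apply: ler_wiXn2l => //; case/andP: q1.
have [v0 _] : exists v, v \in ~: S.
  by apply/card_gt0P; rewrite -(ltr0n R); apply: lt_le_trans bigS; rewrite divr_gt0 ?mulr_gt0.
(* Each of the [r.-1] rounds adds a colour and shrinks the set by at most a factor [p / (16 * r)];
   [hub_last] then handles the remaining colour. *)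
suff level k : (k <= r.-1)%N -> few_trees \/ exists C x S',
    [/\ hub G f C x S', #|C| = k, s0 * (p / (16 * r%:R)) ^+ k <= #|S'|%:R
      & C = set0 -> 8 * L / p <= #|~: S'|%:R].
  have [//|[C [x [S' [hubS' cC S'big _]]]]] := level _ (leqnn _).
  have /eqP/cards1P[c0 Cc0] : #|~: C| = 1%N by rewrite cardsCs setCK card_ord cC; case: (r) r_ge2 => [//|n _]; rewrite /= subSnn.
  apply: (@hub_last c0 x S'); first by rewrite -[[set~ _]]/(~: _) -Cc0 setCK.
  by apply: le_trans (bigk _ (leqnn _)) _; rewrite ler_pM2l.
elim: k => [_|k IHk kr].
  right; exists set0, (fun=> v0), S; split; rewrite ?cards0 ?expr0 ?mulr1 //.
  by move=> i s; rewrite inE.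
have [|[C [x [S' [hubS' cC S'big CS']]]]] := IHk (ltnW kr); first by left.
have [||[c [v [cC' vbig]]]] := hub_step hubS' _ CS'; [|by left|].
  by apply: le_trans (bigk k (ltnW kr)) _; rewrite ler_pM2l.
right; exists (c |: C), (fun i => if i == c then v else x i), [set s in S' | cadj G f c v s].
split.
- move=> i s; rewrite !inE => /predU1P[->|iC] /andP[sS' vs]; first by rewrite eqxx.
  by case: eqP => [->//|_]; apply: hubS'.
- by rewrite cardsU1 cC' cC.
- by apply: le_trans vbig; rewrite exprS mulrCA ler_pM2l.
- by move/setP/(_ c); rewrite !inE eqxx.
Qed.

End Sparse.

(** * Expectations under the random graph *)

Section Stars.
Variables (V : finType).

Definition star (z : V) (M : {set V}) : graph V :=
  [set e | [exists u in M, val e == [set z; u]]].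

Lemma star_subset (G : graph V) z (M : {set V}) : z \notin M ->
  (star z M \subset G) = [forall u in M, adj G z u].
Proof.
move=> zM; apply/subsetP/forall_inP=> [sG u uM|adjG e].
  have zu : #|[set z; u]| == 2%N.
    by rewrite cards2 (_ : z != u) //; apply: contraNneq zM => ->.
  apply/adjP; exists (Sub [set z; u] zu : vpair V); last by rewrite SubK.
  by apply: sG; rewrite inE; apply/exists_inP; exists u; rewrite ?SubK.
rewrite inE => /exists_inP[u uM /eqP ezu]; have /adjP[e' e'G e'zu] := adjG u uM.
by rewrite (_ : e = e') //; apply: val_inj; rewrite ezu e'zu.
Qed.

Lemma card_star z (M : {set V}) : z \notin M -> #|star z M| = #|M|.
Proof.
move=> zM; rewrite -(card_imset _ val_inj) -(card_in_imset (f := fun u => [set z; u]) (D := mem M)).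
  apply: eq_card => B; apply/imsetP/imsetP=> [[e]|[u uM ->]].
    by rewrite inE => /exists_inP[u uM /eqP ezu] ->; exists u.
  have zu : #|[set z; u]| == 2%N.
    by rewrite cards2 (_ : z != u) //; apply: contraNneq zM => ->.
  exists (Sub [set z; u] zu : vpair V); last by rewrite SubK.
  by rewrite inE; apply/exists_inP; exists u; rewrite ?SubK.
move=> u v uM vM /set2_eqP[[]//|[zv _]].
by rewrite zv (vM : v \in M) in zM.
Qed.

Lemma disjoint_star z z' (M M' : {set V}) : z \notin M' -> z' \notin M -> z != z' ->
  [disjoint star z M & star z' M'].
Proof.
move=> zM zM' zz'; apply/pred0P=> e; rewrite /= !inE; apply/negP=> /andP[/exists_inP[u uM /eqP->]].
case/exists_inP=> v vM' /eqP/set2_eqP[[zE _]|[zE _]]; first by rewrite zE eqxx in zz'.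
by rewrite zE vM' in zM.
Qed.

End Stars.

Section Mean.
Variables (R : realFieldType) (V : finType) (p : R).

Definition gnp_weight (G : graph V) : R :=
  \prod_(e : vpair V) (if e \in G then p else 1 - p).

Definition gnp_mean (X : graph V -> R) : R := \sum_G gnp_weight G * X G.

Lemma gnp_mean_sum (I : finType) (P : pred I) (X : I -> graph V -> R) :
  gnp_mean (fun G => \sum_(i | P i) X i G) = \sum_(i | P i) gnp_mean (X i).
Proof. by rewrite exchange_big /=; apply: eq_bigr => G _; rewrite mulr_sumr. Qed.

Lemma gnp_meanZ a (X : graph V -> R) : gnp_mean (fun G => a * X G) = a * gnp_mean X.
Proof. by rewrite mulr_sumr; apply: eq_bigr => G _; rewrite mulrCA. Qed.

(** Giving weight 0 to the non-edges in [A] encodes the containment. The sum then factors over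
    pairs, with factor [p] on [A] and [p + (1 - p)] elsewhere. *)
Lemma gnp_mean_contains (A : graph V) : gnp_mean (fun G => (A \subset G)%:R) = p ^+ #|A|.
Proof.
transitivity (\sum_(G : graph V) \prod_e (if e \in G then p else if e \in A then 0 else 1 - p)).
  apply: eq_bigr => G _; have [/subsetP AG|/subsetPn[e eA eG]] := boolP (A \subset G).
    rewrite mulr1; apply: eq_bigr => e _; case: ifPn => // eG.
    by case: ifP => // /AG; rewrite (negbTE eG).
  by rewrite mulr0 (bigD1 e) //= (negbTE eG) eA mul0r.
rewrite -(bigA_distr _ _ (fun=> p)) /= (bigID (mem A)) /=.
rewrite (eq_bigr (fun=> p)) => [|e ->]; last by rewrite addr0.
rewrite prodr_const big1 ?mulr1 // => e /negbTE->; ring.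
Qed.

Lemma gnp_mean1 : gnp_mean (fun=> 1) = 1.
Proof.
transitivity (gnp_mean (fun G => (set0 \subset G)%:R)).
  by apply: eq_bigr => G _; rewrite sub0set.
by rewrite gnp_mean_contains cards0.
Qed.

(* Independence of disjoint edge sets, in inclusion-exclusion form: both
   sides expand into the same sum over subfamilies. *)
Lemma gnp_mean_prod (I : finType) (J : {set I}) (A : I -> graph V) (m : nat) (t : R) :
  {in J, forall i, #|A i| = m} ->
  {in J &, forall i j, i != j -> [disjoint A i & A j]} ->
  gnp_mean (fun G => \prod_(i in J) (1 - t * (A i \subset G)%:R)) = (1 - t * p ^+ m) ^+ #|J|.
Proof.
move=> cA dA.
(* The product over [J] is expanded over all subsets of [I]; those not contained in [J] contribute
   0. *)
transitivity (\sum_(K : {set I} | K \subset J)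
    gnp_mean (fun G => (- t) ^+ #|K| * (\bigcup_(i in K) A i \subset G)%:R)).
  rewrite -gnp_mean_sum; apply: eq_bigr => G _; congr (_ * _).
  transitivity (\prod_i ((if i \in J then - t * (A i \subset G)%:R else 0) + 1)).
    rewrite big_mkcond; apply: eq_bigr => i _; case: ifP => _; ring.
  rewrite bigA_distr [RHS]big_mkcond /=; apply: eq_bigr => K _.
  rewrite -big_mkcond /=; case: ifPn => [/subsetP KJ|/subsetPn[i iK iJ]]; last first.
    by rewrite (bigD1 i) //= (negbTE iJ) mul0r.
  have [KG|] := boolP (\bigcup_(i in K) A i \subset G).
    rewrite mulr1 -prodr_const; apply: eq_bigr => i iK; rewrite (KJ i iK).
    by rewrite (subset_trans (bigcup_sup i iK) KG) mulr1.
  move=> /subsetPn[e /bigcupP[i iK eA] eG]; rewrite mulr0 (bigD1 i) //= (KJ i iK).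
  by rewrite (_ : _ \subset _ = false) ?mulr0 ?mul0r //; apply: contraNF eG => /subsetP->.
transitivity (\sum_(K : {set I} | K \subset J) (- t * p ^+ m) ^+ #|K|).
  apply: eq_bigr => K /subsetP KJ; rewrite gnp_meanZ gnp_mean_contains.
  rewrite (_ : #|\bigcup_(i in K) A i| = m * #|K|)%N; first by rewrite exprMn -exprM.
  rewrite big_mkcond -sum1_card (partition_disjoint_bigcup _ (fun=> 1%N)) /=.
    rewrite mulnC -sum_nat_const [RHS]big_mkcond; apply: eq_bigr => i _.
    by case: ifP => iK; rewrite sum1_card ?cards0 // cA ?KJ.
  move=> i j ij; case: ifP => [/KJ iJ|_]; last by rewrite -setI_eq0 set0I.
  case: ifP => [/KJ jJ|_]; last by rewrite -setI_eq0 setI0.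
  exact: dA.
rewrite -prodr_const.
transitivity (\prod_i ((if i \in J then - t * p ^+ m else 0) + 1)); last first.
  rewrite [RHS]big_mkcond; apply: eq_bigr => i _; case: ifP => _; ring.
rewrite bigA_distr big_mkcond /=; apply: eq_bigr => K _.
rewrite -big_mkcond /=; case: ifPn => [/subsetP KJ|/subsetPn[i iK iJ]]; last first.
  by rewrite (bigD1 i) //= (negbTE iJ) mul0r.
by rewrite -prodr_const; apply: eq_bigr => i iK; rewrite (KJ i iK).
Qed.

(** Generating function of a binomial variable: the vertices outside [M] are independently common
    neighbours of [M], as their stars to [M] are disjoint, and no vertex of [M] is one. *)
Lemma gnp_mean_common (M : {set V}) (t : R) :
  gnp_mean (fun G => (1 - t) ^+ #|common_nbrs G M|) = (1 - t * p ^+ #|M|) ^+ (#|V| - #|M|).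
Proof.
have -> : (#|V| - #|M| = #|~: M|)%N by rewrite [RHS]cardsCs setCK.
rewrite -(@gnp_mean_prod V (~: M) (fun z => star z M)).
- apply: eq_bigr => G _; congr (_ * _).
  rewrite -prodr_const big_mkcond [RHS]big_mkcond; apply: eq_bigr => z _.
  rewrite !inE; have [zM|zM] /= := boolP (z \in M).
    case: ifP => // /forall_inP/(_ z zM)/adj_neq; by rewrite eqxx.
  by rewrite star_subset //; case: [forall u in M, _]; rewrite ?mulr1 ?mulr0 ?subr0.
- by move=> z; rewrite inE; apply: card_star.
- by move=> z z'; rewrite !inE; apply: disjoint_star.
Qed.

(** The number of edges between [A] and [D] is binomial; each edge is treated as a star with one
    leaf. *)
Lemma gnp_mean_edges (A D : {set V}) : [disjoint A & D] ->
  gnp_mean (fun G => 2^-1 ^+ (\sum_(a in A) #|nbrs_in G a D|)) =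
    (1 - 2^-1 * p) ^+ (#|A| * #|D|).
Proof.
move=> dAD; have AD a : a \in A -> a \in D -> False by move=> aA; rewrite (disjointFr dAD aA).
rewrite -cardsX -[X in _ * X]expr1.
rewrite -(@gnp_mean_prod (V * V)%type (setX A D) (fun ad => star ad.1 [set ad.2])).
- apply: eq_bigr => G _; congr (_ * _).
  rewrite expr_sum.
  rewrite (eq_bigl (fun ad => (ad.1 \in A) && (ad.2 \in D))); last by case=> a d; rewrite inE.
  rewrite -(pair_big (mem A) (mem D) (fun a d => 1 - 2^-1 * (star a [set d] \subset G)%:R)) /=.
  apply: eq_bigr => a aA; rewrite -prodr_const big_mkcond [RHS]big_mkcond.
  apply: eq_bigr => d _; rewrite inE; case: (boolP (d \in D)) => //= dD.
  have ad : a \notin [set d] by rewrite inE; apply/negP=> /eqP adE; apply: (AD a) => //; rewrite adE.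
  rewrite star_subset // (_ : [forall u in _, _] = adj G a d).
    by case: (adj G a d); rewrite ?mulr1 ?mulr0 ?subr0 //; lra.
  by apply/forall_inP/idP=> [/(_ d (set11 d))//|ad' u /set1P->].
- case=> a d; rewrite inE /= => /andP[aA dD]; rewrite card_star ?cards1 // inE.
  by apply/negP=> /eqP adE; apply: (AD a) => //; rewrite adE.
- case=> [a d] [a' d']; rewrite !inE /= => /andP[aA dD] /andP[aA' dD'] neq.
  have ne x y : x \in A -> y \in D -> x != y.
    by move=> xA yD; apply/negP=> /eqP xE; apply: (AD x) => //; rewrite xE.
  have [aa|aa] := eqVneq a a'; last by apply: disjoint_star => //; rewrite inE ne.
  apply/pred0P=> e; rewrite /= !inE; apply/negP=> /andP[/exists_inP[u /set1P-> /eqP->]].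
  case/exists_inP=> u' /set1P-> /eqP/set2_eqP[[_ dE]|[adE _]].
    by rewrite aa dE eqxx in neq.
  by have := ne _ _ aA dD'; rewrite adE eqxx.
Qed.

End Mean.

(* Imported only here because the sets of [classical_sets] shadow those of finset. *)
From mathcomp Require Import all_classical all_reals all_analysis.
Import numFieldNormedType.Exports.

(** * From expectations to probabilities *)

Lemma gnp_weight_ge0 (R : realFieldType) (V : finType) (p : R) (G : graph V) :
  0 <= p <= 1 -> 0 <= gnp_weight p G.
Proof.
by move=> /andP[p0 p1]; apply: prodr_ge0 => e _; case: ifP; rewrite ?subr_ge0.
Qed.

Lemma Gnp_pr_le1 (R : realType) (V : finType) (p : R) (A : graph V -> Prop) :
  0 <= p <= 1 -> Gnp_pr p A <= 1.
Proof.
move=> p01; rewrite -(gnp_mean1 V p) /Gnp_pr big_mkcond; apply: ler_sum => G _.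
by rewrite mulr1; case: ifP => // _; apply: gnp_weight_ge0.
Qed.

(** Markov's inequality: [X] dominates the indicator of the failure of [A]. *)
Lemma Gnp_pr_ge (R : realType) (V : finType) (p : R) (A : graph V -> Prop) (X : graph V -> R) :
  0 <= p <= 1 -> (forall G, 0 <= X G) -> (forall G, ~ A G -> 1 <= X G) ->
  1 - gnp_mean p X <= Gnp_pr p A.
Proof.
move=> p01 X0 X1; rewrite lerBlDr -(gnp_mean1 V p) /Gnp_pr big_mkcond -big_split /=.
apply: ler_sum => G _; rewrite mulr1 -/(gnp_weight p G); have w0 := gnp_weight_ge0 G p01.
case: ifPn => [_|/asboolPn/X1 GX]; first by rewrite lerDl mulr_ge0.
by rewrite add0r ler_peMr.
Qed.

(** * Expected weights of bad configurations *)

Section Estimates.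
Variable R : realType.

Lemma expr_onem_le (x : R) (k : nat) : x <= 1 -> (1 - x) ^+ k <= expR (- (x * k%:R)).
Proof.
move=> x1; rewrite -mulNr mulrC expRM_natl lerXn2r ?nnegrE ?subr_ge0 ?expR_ge0 //.
exact: expR_ge1Dx.
Qed.

Lemma expRN_le_pow (n k : nat) (y : R) : (0 < n)%N -> k%:R * ln n%:R <= y ->
  expR (- y) <= (n%:R ^+ k)^-1.
Proof.
move=> n0 ky; apply: (@le_trans _ _ (expR (- (k%:R * ln n%:R)))); first by rewrite ler_expR lerN2.
by rewrite expRN expRM_natl lnK // posrE ltr0n.
Qed.

Lemma powR_root_le (a p : R) (k : nat) : (0 < k)%N -> 0 <= a -> a `^ (k%:R^-1) <= p -> a <= p ^+ k.
Proof.
move=> k0 a0 ap; have p0 : 0 <= p by apply: le_trans ap; apply: powR_ge0.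
have -> : a = (a `^ (k%:R^-1)) ^+ k.
  by rewrite -powR_mulrn ?powR_ge0 // -powRrM mulVf ?powRr1 // pnatr_eq0 -lt0n.
by rewrite lerXn2r ?nnegrE ?powR_ge0.
Qed.

Lemma bin_le_expn (n m : nat) : ('C(n, m) <= n ^ m)%N.
Proof.
have H : (n ^_ m <= n ^ m)%N.
  elim: m => // m IHm; rewrite ffactnSr expnSr leq_mul //; exact: leq_subr.
by apply: leq_trans H; rewrite -bin_ffact leq_pmulr // fact_gt0.
Qed.

(** For [m = 3], [k = 1], [t = 1/2] the terms are [n / 2 ^ c], where [c] counts common neighbours;
    for [k = 0], [t = 1] they indicate that [M] has no common neighbour. *)
Definition common_weight (n m k : nat) (t : R) (G : graph 'I_n) : R :=
  \sum_(M : {set 'I_n} | #|M| == m) n%:R ^+ k * (1 - t) ^+ #|common_nbrs G M|.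

Lemma common_weight_ge (n m k : nat) (t : R) (G : graph 'I_n) (M : {set 'I_n}) :
  t <= 1 -> #|M| = m -> n%:R ^+ k * (1 - t) ^+ #|common_nbrs G M| <= common_weight m k t G.
Proof.
move=> t1 /eqP cM; rewrite /common_weight (bigD1 M) //= lerDl sumr_ge0 // => B _.
by rewrite mulr_ge0 ?exprn_ge0 ?ler0n ?subr_ge0.
Qed.

Lemma common_weight_ge0 (n m k : nat) (t : R) (G : graph 'I_n) :
  t <= 1 -> 0 <= common_weight m k t G.
Proof.
by move=> t1; apply: sumr_ge0 => M _; rewrite mulr_ge0 ?exprn_ge0 ?ler0n ?subr_ge0.
Qed.

Lemma tp_of_common_weight (n : nat) (G : graph 'I_n) : (2 < n)%N ->
  2 * common_weight 3 1 2^-1 G < 1 -> (tp 2 G <= 2)%N.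
Proof.
move=> n2 wG; apply: tree_partition_number_le2; rewrite card_ord // => M cM.
have half1 : 2^-1 <= 1 :> R by lra.
have := common_weight_ge 1 G half1 cM.
rewrite expr1 (_ : 1 - 2^-1 = 2^-1 :> R); last by lra.
rewrite exprVn ler_pdivrMr ?exprn_gt0 // => wn; rewrite -(ltr_nat R) natrM natrX.
apply: (@le_lt_trans _ _ (2 * common_weight 3 1 2^-1 G * 2 ^+ #|common_nbrs G M|)).
  by rewrite -mulrA ler_pM2l.
by rewrite gtr_pMl // exprn_gt0.
Qed.

Lemma tc_of_common_weight (n r : nat) (G : graph 'I_n) :
  common_weight r.+1 0 1 G < 1 -> (tc r G <= r ^ 2)%N.
Proof.
move=> wG; apply: tree_cover_number_le => M cM.
have := le_lt_trans (common_weight_ge 0 G (lexx 1) cM) wG.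
rewrite expr0 mul1r subrr expr0n; case: (posnP #|common_nbrs G M|) => [_|/card_gt0P[z]].
  by rewrite ltxx.
by rewrite inE => /forall_inP zM _; exists z.
Qed.

(** Union bound: at most [n ^ m] sets, each with mean at most [n ^ k * n ^ -(m + k + 1)]. *)
Lemma common_weight_mean_le (n m k : nat) (p t : R) :
  (0 < n)%N -> 0 <= p <= 1 -> 0 <= t <= 1 ->
  (m + k + 1)%:R * ln n%:R <= t * p ^+ m * (n - m)%:R ->
  gnp_mean p (@common_weight n m k t) <= n%:R^-1.
Proof.
move=> n0 p01 /andP[t0 t1] big; rewrite gnp_mean_sum.
rewrite (eq_bigr (fun=> n%:R ^+ k * (1 - t * p ^+ m) ^+ (n - m))); last first.
  by move=> M /eqP cM; rewrite gnp_meanZ gnp_mean_common cM card_ord.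
rewrite sumr_const -cardsE card_draws card_ord -[leLHS]mulr_natl mulrA.
have n0R : 0 < n%:R :> R by rewrite ltr0n.
have tp : t * p ^+ m <= 1.
  case/andP: p01 => p0 p1; rewrite -[leRHS]mulr1 ler_pM ?exprn_ge0 //.
  by apply: exprn_ile1.
apply: (@le_trans _ _ ((n%:R ^+ m * n%:R ^+ k) * (n%:R ^+ (m + k + 1))^-1)); last first.
  by rewrite -exprD addn1 exprS invfM mulrCA mulfV ?mulr1 // expf_neq0 // gt_eqF.
apply: ler_pM => //.
- by rewrite exprn_ge0 // subr_ge0.
- by rewrite ler_wpM2r ?exprn_ge0 ?ler0n // -natrX ler_nat bin_le_expn.
exact: le_trans (expr_onem_le _ tp) (expRN_le_pow n0 big).
Qed.

Lemma sum_sets_pow (V : finType) (x : R) :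
  \sum_(A : {set V}) x ^+ #|A| = (1 + x) ^+ #|V|.
Proof.
rewrite addrC -prodr_const bigA_distr; apply: eq_bigr => A _.
by rewrite -prodr_const big_mkcond.
Qed.

(** The sum is [(1 + 1/n) ^ n]; a union bound with a factor [1/n] per chosen vertex thus costs only
    a constant. *)
Lemma sum_sets_le_exp1 (n : nat) : \sum_(A : {set 'I_n}) n%:R^-1 ^+ #|A| <= expR 1 :> R.
Proof.
rewrite sum_sets_pow card_ord; case: n => [|n]; first by rewrite expr0 -expR0 ler_expR.
rewrite -[X in expR X](@mulfV _ n.+1%:R) ?pnatr_eq0 // expRM_natl.
by rewrite lerXn2r ?nnegrE ?expR_ge0 ?addr_ge0 ?invr_ge0 ?ler0n // expR_ge1Dx.
Qed.

(* An exponential-moment weight: the term of (A, D) is at least 1 as soon as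
   (A, D) has too few edges for [jumbled]. *)
Definition sparse_weight (n : nat) (p L : R) (G : graph 'I_n) : R :=
  \sum_(AD : {set 'I_n} * {set 'I_n} | [&& [disjoint AD.1 & AD.2],
      8 * L / p <= #|AD.1|%:R & 16 * L / p <= #|AD.2|%:R])
    expR (p * #|AD.1|%:R * #|AD.2|%:R / 8) * 2^-1 ^+ (\sum_(a in AD.1) #|nbrs_in G a AD.2|).

Lemma sparse_weight_ge0 (n : nat) (p L : R) (G : graph 'I_n) : 0 <= sparse_weight p L G.
Proof. by apply: sumr_ge0 => AD _; rewrite mulr_ge0 ?expR_ge0 ?exprn_ge0. Qed.

Lemma jumbled_of_sparse_weight (n : nat) (p L : R) (G : graph 'I_n) :
  sparse_weight p L G < 1 -> jumbled G p L.
Proof.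
move=> wG A D dAD bigA bigD; rewrite ltNge; apply/negP=> few.
move: wG; apply/negP; rewrite -leNgt /sparse_weight (bigD1 (A, D)) /=; last by rewrite dAD bigA.
set e := (\sum_(a in A) _)%N in few *.
apply: (@le_trans _ _ (expR (p * #|A|%:R * #|D|%:R / 8) * 2^-1 ^+ e)); last first.
  by rewrite lerDl sumr_ge0 // => AD _; rewrite mulr_ge0 ?expR_ge0 ?exprn_ge0.
rewrite exprVn ler_pdivlMr ?exprn_gt0 // mul1r.
(* Too few edges make the exponential at least [expR e], which exceeds [2 ^ e]. *)
apply: le_trans (_ : expR e%:R <= _); last by rewrite ler_expR.
rewrite -[e%:R]mulr1 expRM_natl lerXn2r ?nnegrE ?expR_ge0 //.
by have := expR_ge1Dx (1 : R); lra.
Qed.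

(** With [a] and [d] the two sizes, a term has mean at most [exp (p a d / 8 - p a d / 2)]. The size
    conditions bound this by [n ^ -(1 + a + d)]. *)
Lemma sparse_weight_mean_le (n : nat) (p : R) : (1 < n)%N -> 0 < p <= 1 ->
  gnp_mean p (@sparse_weight n p (ln n%:R)) <= expR 1 ^+ 2 / n%:R.
Proof.
move=> n1 /andP[p0 p1]; set L := ln n%:R.
have n0 : (0 < n)%N by apply: ltnW.
have n0R : 0 < n%:R :> R by rewrite ltr0n.
have L0 : 0 < L by rewrite ln_gt0 // ltr1n.
rewrite gnp_mean_sum.
apply: (@le_trans _ _ (\sum_(AD : {set 'I_n} * {set 'I_n})
    n%:R^-1 * (n%:R^-1 ^+ #|AD.1| * n%:R^-1 ^+ #|AD.2|))); last first.
  rewrite -mulr_sumr -(pair_bigA _ (fun A D : {set 'I_n} => n%:R^-1 ^+ #|A| * n%:R^-1 ^+ #|D|)) /=.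
  under eq_bigr do rewrite -mulr_sumr.
  rewrite -mulr_suml mulrC ler_wpM2r ?invr_ge0 ?ler0n // expr2.
  by apply: ler_pM; rewrite ?sum_sets_le_exp1 // sumr_ge0 // => A _; rewrite exprn_ge0 // invr_ge0 ler0n.
rewrite big_mkcond /=; apply: ler_sum => -[A D] _ /=.
case: ifPn => [/and3P[dAD bigA bigD]|_]; last first.
  by rewrite !mulr_ge0 ?exprn_ge0 ?invr_ge0 ?ler0n.
rewrite gnp_meanZ gnp_mean_edges //.
set a := #|A| in bigA *; set d := #|D| in bigD *.
have pa : 8 * L <= p * a%:R by rewrite [leRHS]mulrC -ler_pdivrMr.
have pd : 16 * L <= p * d%:R by rewrite [leRHS]mulrC -ler_pdivrMr.
have a1 : (1 <= a)%N.
  by rewrite -(ltr0n R) -(pmulr_rgt0 _ p0); apply: lt_le_trans pa; rewrite mulr_gt0.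
have half : 2^-1 * p <= 1 by lra.
apply: (@le_trans _ _ (expR (- ((1 + a + d)%N%:R * L)))).
  apply: (@le_trans _ _ (expR (p * a%:R * d%:R / 8) * expR (- (2^-1 * p * (a * d)%N%:R)))).
    by rewrite ler_wpM2l ?expR_ge0 // expr_onem_le.
  rewrite -expRD ler_expR natrM !natrD.
  have ad : 8 * L * d%:R <= p * a%:R * d%:R by rewrite ler_wpM2r.
  have da : 16 * L * a%:R <= p * d%:R * a%:R by rewrite ler_wpM2r.
  have aL : L <= L * a%:R by rewrite ler_peMr ?ler1n // ltW.
  have dL : 0 <= L * d%:R by rewrite mulr_ge0 // ltW.
  lra.
apply: le_trans (expRN_le_pow n0 (lexx _)) _.
by rewrite -!exprVn !exprD expr1 mulrA.
Qed.

(* Starting from half of the vertices, r - 1 steps of [hub_step] leave a set S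
   with p |S| >= 64 r^2 log n when p^r n >= threshold r * log n. *)
Definition threshold (r : nat) : R := 128 * r%:R ^+ 2 * (16 * r%:R) ^+ r.-1.

Lemma threshold_ge (r : nat) : (2 <= r)%N -> 128 * r%:R <= threshold r.
Proof.
move=> r2; have r2R : 2 <= r%:R :> R by rewrite ler_nat.
have r0 : 0 <= r%:R :> R by rewrite ler0n.
rewrite /threshold -mulrA ler_pM2l // -[leLHS]mulr1 expr2 -mulrA ler_wpM2l //.
rewrite mulr_ege1 //; first by lra.
by apply: exprn_ege1; lra.
Qed.

Lemma few_trees_of_sparse_weight (n r : nat) (p : R) (G : graph 'I_n) (f : coloring 'I_n r) :
  (2 <= r)%N -> (2 * r <= n)%N -> 0 < p <= 1 ->
  threshold r * ln n%:R / n%:R <= p ^+ r ->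
  sparse_weight p (ln n%:R) G < 1 -> few_trees G f p (ln n%:R).
Proof.
move=> r2 rn /andP[p0 p1] pr /jumbled_of_sparse_weight jG; set L := ln n%:R in pr jG *.
have n1 : (1 < n)%N by apply: leq_trans rn; lia.
have n0R : 0 < n%:R :> R by rewrite ltr0n ltnW.
have L0 : 0 < L by rewrite ln_gt0 // ltr1n.
have r2R : 2 <= r%:R :> R by rewrite ler_nat.
have r0 : 0 < r%:R :> R by rewrite ltr0n (leq_trans _ r2).
have r_inv : r%:R^-1 <= 1 :> R by rewrite invf_le1 // (le_trans _ r2R) // ler1n.
have prn : threshold r * L <= p ^+ r * n%:R by rewrite -ler_pdivrMr.
apply: (@few_trees_exist R _ G r f p L r2 p0 p1 L0 jG _ (n%:R / 2)).
(* As [m / r >= 2 * ln n], the bound is [n / n ^ 2], and [1 / n <= 1 / (2 * r)]. *)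
- move=> m mL; apply: (@le_trans _ _ (n%:R * (n%:R ^+ 2)^-1)).
    rewrite card_ord ler_wpM2l ?ler0n //; apply: le_trans (expr_onem_le _ r_inv) _.
    apply: expRN_le_pow; first exact: ltnW.
    by rewrite [leRHS]mulrC ler_pdivlMr // mulrAC.
  by rewrite expr2 invfM mulVKf ?gt_eqF // -natrM lef_pV2 ?posrE ?ltr0n ?ler_nat //; lia.
- have q0 : 0 < (16 * r%:R) ^+ r.-1 :> R by rewrite exprn_gt0 ?mulr_gt0.
  have pS : p ^+ r = p * p ^+ r.-1 by rewrite -exprS prednK // (leq_trans _ r2).
  rewrite expr_div_n; move: prn q0; rewrite /threshold pS.
  set q := (16 * r%:R) ^+ r.-1; set P := p ^+ r.-1 => prn q0.
  have -> : p * (n%:R / 2 * (P / q)) = p * P * n%:R / 2 / q by field; rewrite gt_eqF.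
  rewrite ler_pdivlMr //; lra.
(* Any half of the vertices will do; rounding up gives [n / 2 <= #|S|], and the complement still has
   at least [n / 4] vertices. *)
have [S _ cS] : exists2 S : {set 'I_n}, S \subset [set: 'I_n] & #|S| = uphalf n.
  by apply: subset_card_exists; rewrite cardsT card_ord uphalf_half; have := odd_double_half n; lia.
exists S.
  rewrite cS ler_pdivrMr // -natrM ler_nat uphalf_half; have := odd_double_half n; lia.
have cS' : #|~: S| = n./2.
  have := cardsC S; rewrite cS card_ord uphalf_half; have := odd_double_half n; lia.
rewrite cS' ler_pdivrMr //.
have n3 : n%:R / 4 <= n./2%:R :> R.
  rewrite ler_pdivrMr // -natrM ler_nat; have := odd_double_half n; lia.
have prp : p ^+ r <= p.
  by rewrite -[leRHS]expr1 ler_wiXn2l ?(ltW p0) // (leq_trans _ r2).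
have : 128 * 2 * L <= p * n%:R.
  apply: (@le_trans _ _ (p ^+ r * n%:R)); last by rewrite ler_pM2r.
  apply: le_trans prn; rewrite ler_pM2r //; apply: le_trans (threshold_ge r2); lra.
have : p * (n%:R / 4) <= p * n./2%:R by rewrite ler_pM2l.
lra.
Qed.

End Estimates.

Local Open Scope classical_set_scope.

Lemma aas_of_mean (R : realType) (p : nat -> R) (A : forall n, graph 'I_n -> Prop)
    (c : R) (X : forall n, graph 'I_n -> R) :
  (forall n, 0 <= p n <= 1) ->
  (\forall n \near \oo, [/\ forall G : graph 'I_n, 0 <= X n G,
     forall G : graph 'I_n, ~ A n G -> 1 <= X n G & gnp_mean (p n) (X n) <= c / n%:R]) ->
  aas p A.
Proof.
move=> p01 nearX; rewrite /aas.
apply: (@squeeze_cvgr _ _ _ _ (fun n => 1 - c / n%:R) (fun=> 1)); last exact: cvg_cst.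
  near=> n; rewrite Gnp_pr_le1 // andbT.
  have [X0 X1 EX] : [/\ forall G : graph 'I_n, 0 <= X n G,
     forall G : graph 'I_n, ~ A n G -> 1 <= X n G & gnp_mean (p n) (X n) <= c / n%:R] by near: n.
  by apply: le_trans (Gnp_pr_ge (p01 n) X0 X1); rewrite lerB.
rewrite -[X in _ --> X]subr0; apply: cvgB; first exact: cvg_cst.
rewrite -[X in _ --> X](mulr0 c); apply: cvgM; first exact: cvg_cst.
rewrite -cvg_shiftS; exact: (@cvg_harmonic R).
Unshelve. all: by end_near. Qed.

(** * Asymptotics *)

Lemma root_threshold (R : realType) (C p : R) (n k : nat) :
  (1 < n)%N -> (0 < k)%N -> 0 < C -> (C * ln n%:R / n%:R) `^ (k%:R)^-1 <= p ->
  0 < p /\ C * ln n%:R / n%:R <= p ^+ k.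
Proof.
move=> n1 k0 C0 Cp.
have q0 : 0 < C * ln n%:R / n%:R :> R.
  by rewrite divr_gt0 ?mulr_gt0 ?ln_gt0 ?ltr1n // ltr0n ltnW.
split; first by apply: lt_le_trans Cp; apply: powR_gt0.
exact: powR_root_le (ltW q0) Cp.
Qed.

Lemma half_gap (R : realType) (n m : nat) : (2 * m <= n)%N -> n%:R / 2 <= (n - m)%:R :> R.
Proof. by move=> mn; rewrite ler_pdivrMr // -natrM ler_nat; lia. Qed.

Lemma aas_tp (R : realType) (p : nat -> R) : (forall n, 0 <= p n <= 1) ->
  (\forall n \near \oo, (27 * ln n%:R / n%:R) `^ (3%:R)^-1 <= p n) ->
  aas p (fun n (G : graph 'I_n) => (tp 2 G <= 2)%N).
Proof.
move=> p01 nearp.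
apply: (@aas_of_mean _ _ _ 2 (fun n G => 2 * common_weight 3 1 2^-1 G)) => //.
near=> n.
have n6 : (6 <= n)%N by near: n; exact: nbhs_infty_ge.
have pn : (27 * ln n%:R / n%:R) `^ (3%:R)^-1 <= p n by near: n.
have [p0 p3] := root_threshold (leq_trans (isT : (1 < 6)%N) n6) (isT : (0 < 3)%N) (ltr0n R 27) pn.
have half1 : 2^-1 <= 1 :> R by lra.
split=> [G|G /negP nG|]; first by rewrite mulr_ge0 // common_weight_ge0.
  rewrite leNgt; apply: contra nG; apply: tp_of_common_weight; exact: leq_trans n6.
rewrite gnp_meanZ ler_wpM2l //; apply: common_weight_mean_le => //; first exact: leq_trans n6.
  by rewrite half1 invr_ge0 ler0n.
have n0 : 0 < n%:R :> R by rewrite ltr0n (leq_trans _ n6).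
have L0 : 0 <= ln n%:R :> R by rewrite ln_ge0 // ler1n (leq_trans _ n6).
move: p3; rewrite ler_pdivrMr // => p3.
have := half_gap R (n6 : (2 * 3 <= n)%N); rewrite -(ler_pM2l (exprn_gt0 3 p0)) => gap.
(* The requirement is [5 * ln n <= p ^ 3 * (n - 3) / 2], and the right side is at least
   [27 / 4 * ln n]. *)
rewrite -mulrA; lra.
Unshelve. all: by end_near. Qed.

Lemma aas_tc (R : realType) (r : nat) (C : R) (p : nat -> R) : (forall n, 0 <= p n <= 1) ->
  2 * (r%:R + 2) <= C ->
  (\forall n \near \oo, (C * ln n%:R / n%:R) `^ (r.+1%:R)^-1 <= p n) ->
  aas p (fun n (G : graph 'I_n) => (tc r G <= r ^ 2)%N).
Proof.
move=> p01 Cr nearp.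
apply: (@aas_of_mean _ _ _ 1 (fun n G => common_weight r.+1 0 1 G)) => //.
near=> n.
have nr : (2 * r.+1 <= n)%N by near: n; exact: nbhs_infty_ge.
have pn : (C * ln n%:R / n%:R) `^ (r.+1%:R)^-1 <= p n by near: n.
have r0 : 0 <= r%:R :> R by rewrite ler0n.
have n1 : (1 < n)%N by lia.
have [p0 pr] : 0 < p n /\ C * ln n%:R / n%:R <= p n ^+ r.+1.
  by apply: root_threshold => //; lra.
split=> [G|G /negP nG|]; first exact: common_weight_ge0.
  by rewrite leNgt; apply: contra nG; apply: tc_of_common_weight.
rewrite mul1r; apply: common_weight_mean_le => //; [exact: ltnW|by rewrite ler01 lexx|].
have n0 : 0 < n%:R :> R by rewrite ltr0n ltnW.
have L0 : 0 < ln n%:R :> R by rewrite ln_gt0 // ltr1n.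
move: pr; rewrite ler_pdivrMr // => pr; rewrite mul1r.
have := half_gap R nr; rewrite -(ler_pM2l (exprn_gt0 r.+1 p0)); apply: le_trans.
(* Here [r + 2] is the exponent [m + k + 1] of the union bound, and [n - (r + 1) >= n / 2] doubles
   it. *)
rewrite mulrA ler_pdivlMr //; apply: le_trans pr.
rewrite mulrAC ler_pM2r //; apply: le_trans Cr; rewrite addn0 !natrD natr1; lra.
Unshelve. all: by end_near. Qed.

Lemma aas_few_trees (R : realType) (r : nat) (p : nat -> R) : (2 <= r)%N ->
  (forall n, 0 <= p n <= 1) ->
  (\forall n \near \oo, (threshold R r * ln n%:R / n%:R) `^ (r%:R)^-1 <= p n) ->
  aas p (fun n (G : graph 'I_n) => forall f : coloring 'I_n r,
    exists HH : {set subgraph 'I_n},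
      [/\ (#|HH| <= r)%N, forall H, H \in HH -> mono_tree G f H, vertex_disjoint HH
        & #|uncovered HH|%:R <= 9 * r%:R * ln n%:R / p n]).
Proof.
move=> r2 p01 nearp.
have T0 : 0 < threshold R r.
  by apply: lt_le_trans (threshold_ge R r2); rewrite mulr_gt0 // ltr0n (leq_trans _ r2).
apply: (@aas_of_mean _ _ _ (expR 1 ^+ 2) (fun n G => sparse_weight (p n) (ln n%:R) G)) => //.
near=> n.
have nr : (2 * r <= n)%N by near: n; exact: nbhs_infty_ge.
have pn : (threshold R r * ln n%:R / n%:R) `^ (r%:R)^-1 <= p n by near: n.
have n1 : (1 < n)%N by apply: leq_trans nr; lia.
have [p0 pr] := root_threshold n1 (ltnW r2) T0 pn.
have p1 : 0 < p n <= 1 by rewrite p0; case/andP: (p01 n).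
split=> [G|G nG|]; [exact: sparse_weight_ge0| |exact: sparse_weight_mean_le].
rewrite leNgt; apply/negP=> wG; apply: nG => f.
have [HH [cH tH dH uH]] := few_trees_of_sparse_weight f r2 nr p1 pr wG.
exists HH; split=> //; apply: le_trans uH _.
rewrite ler_pM2r ?invr_gt0 // ler_wpM2r //; first by rewrite ln_ge0 // ler1n ltnW.
(* [16 <= 9 * r] because [r >= 2]. *)
by rewrite -!natrM ler_nat; lia.
Unshelve. all: by end_near. Qed.

(** At the smallest admissible [p] the two functions differ exactly by the factor
    [9 * r / C ^ (1/r)], and a larger [p] only decreases the first. *)
Lemma leftover_bigO (R : realType) (r : nat) (C : R) (p : nat -> R) : (2 <= r)%N -> 0 < C ->
  (\forall n \near \oo, (C * ln n%:R / n%:R) `^ (r%:R)^-1 <= p n) ->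
  (fun n : nat => 9 * r%:R * ln n%:R / p n : R^o) =O_\oo
    (fun n : nat => n%:R `^ (r%:R)^-1 * ln n%:R `^ (1 - (r%:R)^-1) : R^o).
Proof.
move=> r2 C0 nearp; apply/eqO_exP; exists (9 * r%:R / C `^ (r%:R)^-1).
  by rewrite divr_gt0 ?powR_gt0 ?mulr_gt0 // ltr0n (leq_trans _ r2).
near=> n.
have n1 : (1 < n)%N by near: n; exact: nbhs_infty_ge.
have pn : (C * ln n%:R / n%:R) `^ (r%:R)^-1 <= p n by near: n.
have [p0 _] := root_threshold n1 (ltnW r2) C0 pn.
have n0 : 0 < n%:R :> R by rewrite ltr0n ltnW.
have L0 : 0 < ln n%:R :> R by rewrite ln_gt0 // ltr1n.
have r0 : 0 < r%:R :> R by rewrite ltr0n (leq_trans _ r2).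
rewrite ger0_norm; last by rewrite ltW // divr_gt0 ?mulr_gt0.
rewrite ger0_norm; last by rewrite mulr_ge0 ?powR_ge0.
set t := (r%:R)^-1 in pn *.
have qE : (C * ln n%:R / n%:R) `^ t = C `^ t * ln n%:R `^ t / n%:R `^ t.
  rewrite powRM ?invr_ge0 ?(ltW n0) ?(ltW (mulr_gt0 C0 L0)) // powRM ?(ltW C0) ?(ltW L0) //; congr (_ * _).
  by rewrite -powR_inv1 ?(ltW n0) // -powRrM mulN1r powRN.
apply: (@le_trans _ _ (9 * r%:R * ln n%:R / ((C * ln n%:R / n%:R) `^ t))).
  rewrite ler_pM2l ?mulr_gt0 // lef_pV2 // posrE //.
  by rewrite powR_gt0 // divr_gt0 ?mulr_gt0.
have -> : ln n%:R `^ (1 - t) = ln n%:R / ln n%:R `^ t.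
  by rewrite powRB ?(gt_eqF L0) ?implybT // powRr1 // ltW.
rewrite qE.
rewrite le_eqVlt; apply/orP; left; apply/eqP; field.
by rewrite !gt_eqF ?powR_gt0.
Unshelve. all: by end_near. Qed.

Theorem theorem1p6 (R : realType) (r : nat) (r_ge2 : (2 <= r)%N) :
  exists2 C : R, r%:R <= C &
  forall p : nat -> R, (forall n : nat, 0 <= p n <= 1) ->
  [/\ (\forall n \near \oo,
         (27 * ln n%:R / n%:R) `^ (3%:R)^-1 <= p n) ->
      aas p (fun n (G : graph 'I_n) => (tp 2 G <= 2)%N),

      (\forall n \near \oo,
         (C * ln n%:R / n%:R) `^ (r.+1%:R)^-1 <= p n) ->
      aas p (fun n (G : graph 'I_n) => (tc r G <= r ^ 2)%N)

    & (\forall n \near \oo,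
         (C * ln n%:R / n%:R) `^ (r%:R)^-1 <= p n) ->
      aas p (fun n (G : graph 'I_n) =>
        forall f : coloring 'I_n r,
        exists HH : {set subgraph 'I_n},
          [/\ (#|HH| <= r)%N,
              forall H, H \in HH -> mono_tree G f H,
              vertex_disjoint HH
            & #|uncovered HH|%:R <= 9 * r%:R * ln n%:R / p n])
      /\
      ((fun n : nat => 9 * r%:R * ln n%:R / p n : R^o) =O_\oo
         (fun n : nat => n%:R `^ (r%:R)^-1 * ln n%:R `^ (1 - (r%:R)^-1) : R^o))].
Proof.
have r2R : 2 <= r%:R :> R by rewrite ler_nat.
have Tr := threshold_ge R r_ge2.
(* One constant serves both parts: it is at least [128 * r], hence at least [2 * (r + 2)] and
   [r]. *)
exists (threshold R r); first by lra.
move=> p p01; split=> [|nearp|nearp]; first exact: aas_tp.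
  by apply: aas_tc nearp => //; lra.
split; first exact: aas_few_trees.
by apply: leftover_bigO nearp => //; lra.
Qed.
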